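(* Let $A,K_1,\dots,K_n$ be bounded self-adjoint operators on a separable Hilbert space $\mathcal H$, let all $K_k$ be in the trace class, and put $$A_{\vec t}=A+K_{\vec t},\qquad K_{\vec t}=\sum_{k=1}^n t_kK_k,\qquad \vec t=(t_1,\dots,t_n)\in\mathbb R^n.$$ Assume that there exists a set of directions $D\subset S^{n-1}\subset\mathbb R^n$ of positive surface measure such that for all $\vec\tau\in D$ the operator $K_{\vec\tau}$ is non-negative and $\operatorname{Ran}K_{\vec\tau}$ is cyclic for $A$. Then, given an arbitrary singular Radon measure $\sigma$ on $\mathbb R$, the spectral measure of $A_{\vec t}$ is mutually singular with $\sigma$ for all $\vec t\in\mathbb R^n\setminus E$, where the exceptional set $E=E_\sigma$ has Hausdorff dimension at most $n-1$.
   Context: Measures are non-negative Borel measures; ''singular'' means singular with respect to Lebesgue measure. Operators are bounded. For a self-adjoint operator $A$ on $\mathcal H$ with projection-valued spectral measure $\mathbf E$, the scalar spectral measure of $\mathbf x\in\mathcal H$ is $\mu_{\mathbf x}(\cdot)=\langle \mathbf E(\cdot)\mathbf x,\mathbf x\rangle$. A vector $\mathbf x$ has maximal spectral type if $\mu_{\mathbf y}\ll\mu_{\mathbf x}$ for every $\mathbf y\in\mathcal H$. ''The spectral measure of $A$'' means a scalar spectral measure of maximal spectral type, i.e. $\mu_{\mathbf x}$ for some $\mathbf x$ of maximal spectral type; it is unique up to mutual absolute continuity. A set $S\subset\mathcal H$ is cyclic for $A$ if the smallest closed $A$-invariant subspace containing $S$ is $\mathcal H$. *)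

(* Defs.v *)
From HB Require Import structures.
From mathcomp Require Import all_boot all_order all_algebra.
From mathcomp Require Import ring lra complex.
From mathcomp Require Import all_classical all_reals all_analysis.

Set Implicit Arguments.
Unset Strict Implicit.
Unset Printing Implicit Defensive.

Import Order.TTheory GRing.Theory Num.Theory.
Import numFieldNormedType.Exports.

Local Open Scope classical_set_scope.
Local Open Scope ring_scope.
Local Open Scope complex_scope.

(* A complex Hilbert space; the inner product is linear in its first variable. *)
HB.mixin Record CompleteNormedModule_isHilbert (R : realType) H
    of CompleteNormedModule R[i] H := {
  inner : {dot H for Num.conj} ;
  inner_norm : forall x : H, inner x x = `|x| ^+ 2 }.

#[short(type="hilbertType")]
HB.structure Definition Hilbert (R : realType) :=
  {H of CompleteNormedModule_isHilbert R H & CompleteNormedModule R[i] H}.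

Section operators.
Context {R : realType} {H : hilbertType R}.
Implicit Types A T K : H -> H.

Definition bounded_op T :=
  exists M : R, forall x, `|T x| <= M%:C * `|x|.

Definition self_adjoint T := forall x y, inner (T x) y = inner x (T y).

Definition nonneg_op T := forall x, 0 <= inner (T x) x.

(* In a Hilbert space the maximal orthonormal sets are the orthonormal bases. *)
Definition orthonormal_basis (B : set H) :=
  (forall e f, B e -> B f -> inner e f = (e == f)%:R) /\
  (forall x, (forall e, B e -> inner x e = 0) -> x = 0).

(* [P] is the modulus |T|: the non-negative operator with P^2 = T^* T. *)
Definition is_modulus T (P : {linear H -> H}) :=
  [/\ bounded_op P, nonneg_op P &
      forall x y, inner (P (P x)) y = inner (T x) (T y)].

(* tr |T| < +oo; the value of the trace of the non-negative operator |T| does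
   not depend on the orthonormal basis. *)
Definition trace_class T :=
  bounded_op T /\
  exists (P : {linear H -> H}) (B : set H),
    [/\ is_modulus T P, orthonormal_basis B &
        (\esum_(e in B) (complex.Re (inner (P e) e))%:E < +oo)%E].

Definition closed_invariant_subspace A (M : set H) :=
  [/\ closed M, M 0, (forall (a : R[i]) x y, M x -> M y -> M (a *: x + y)) &
      forall x, M x -> M (A x)].

Definition cyclic_set A (S : set H) :=
  smallest (closed_invariant_subspace A) S = setT.

End operators.

Section spectral_measures.
Context {R : realType}.
Local Notation RR := (measurableTypeR R).

(* Only the values [proj B] at Borel sets [B] are meaningful. *)
Record projection_measure (H : hilbertType R) := ProjectionMeasure {
  proj :> set RR -> {linear H -> H} ;
  proj_self_adjoint : forall B, measurable B -> self_adjoint (proj B) ;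
  projI : forall B C, measurable B -> measurable C ->
    forall x, proj (B `&` C) x = proj B (proj C x) ;
  proj0 : forall x, proj set0 x = 0 ;
  projT : forall x, proj setT x = x ;
  proj_sigma_additive : forall F : (set RR)^nat,
    (forall i, measurable (F i)) -> trivIset setT F ->
    forall x, \sum_(0 <= i < n) proj (F i) x @[n --> \oo]
      --> proj (\bigcup_i F i) x }.

(* Measures are total functions on sets: the value at a non-Borel set is
   irrelevant and taken to be 0. *)
Definition scalar_measure (H : hilbertType R) (E : projection_measure H)
    (x : H) (B : set RR) : \bar R :=
  (if `[< measurable B >] then complex.Re (inner (E B x) x) else 0)%:E.

Section scalar_measure_is_measure.
Context (H : hilbertType R) (E : projection_measure H) (x : H).
Local Notation mu := (scalar_measure E x).

Lemma Re_inner_ge0 (u : H) : 0 <= complex.Re (inner u u).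
Proof.
have : 0 <= inner u u by rewrite inner_norm exprn_ge0.
by rewrite lecE => /andP[_].
Qed.

Lemma scalar_measure0 : mu set0 = 0%E.
Proof.
by rewrite /scalar_measure; case: ifP => // _; rewrite proj0 linear0l.
Qed.

Lemma scalar_measure_ge0 B : (0 <= mu B)%E.
Proof.
rewrite /scalar_measure lee_fin; case: asboolP => // mB.
rewrite -[B in E B]setIid (projI E mB mB) (proj_self_adjoint E mB).
exact: Re_inner_ge0.
Qed.

Lemma ReD (z w : R[i]) : complex.Re (z + w) = complex.Re z + complex.Re w.
Proof. by case: z w => [? ?] [? ?]. Qed.

Lemma ReN (z : R[i]) : complex.Re (- z) = - complex.Re z.
Proof. by case: z. Qed.

Lemma ReZ (k : R) (z : R[i]) : complex.Re (k%:C * z) = k * complex.Re z.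
Proof. by case: z => a b /=; rewrite mul0r subr0. Qed.

Lemma Re_innerC (u v : H) : complex.Re (inner u v) = complex.Re (inner v u).
Proof. by rewrite hermC/= expr0 mul1r; case: (inner v u). Qed.

Lemma Re_inner_le (u v : H) (d : R) : 0 < d -> `|u| < d%:C ->
  complex.Re (inner u v) <= d * (1 + complex.Re (inner v v)).
Proof.
move=> d0 ud.
have uu : complex.Re (inner u u) <= d ^+ 2.
  have : inner u u <= (d ^+ 2)%:C.
    rewrite inner_norm rmorphXn/= lerXn2r ?nnegrE ?normr_ge0 ?(ltW ud)//.
    by rewrite ler0c ltW.
  by rewrite lecE => /andP[_].
have := Re_inner_ge0 (u - d%:C *: v).
rewrite linearBl !linearBr/= linearZl_LR/= !linearZ_LR/= linearZl_LR/=.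
have -> : Num.conj d%:C = d%:C.
  by apply: conj_Creal; rewrite complex_real.
rewrite !(ReD, ReN, ReZ) (Re_innerC v u).
set a := complex.Re (inner u u) in uu *; set b := complex.Re (inner u v).
set c := complex.Re (inner v v) => h.
have c0 : 0 <= c by exact: Re_inner_ge0.
have : 0 <= d ^+ 2 * (1 + c) by rewrite mulr_ge0 ?sqr_ge0 ?addr_ge0.
have : d * b <= d * (d * (1 + c)) by nra.
by rewrite ler_pM2l.
Qed.

Lemma Re_inner_cvg (u : H^nat) (v : H) : u @ \oo --> v ->
  complex.Re (inner (u n) x) @[n --> \oo] --> complex.Re (inner v x).
Proof.
move=> uv; apply/cvgrPdist_le => e e0.
have c0 : 0 < 1 + complex.Re (inner x x).
  by rewrite ltr_pwDl// Re_inner_ge0.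
pose d := e / (1 + complex.Re (inner x x)).
have d0 : 0 < d by rewrite divr_gt0.
have de : d * (1 + complex.Re (inner x x)) = e by rewrite divfK ?gt_eqF.
have dC : 0 < d%:C by rewrite ltcR.
move/cvgrPdist_lt: uv => /(_ _ dC); apply: filterS => n un.
rewrite -ReN -ReD -linearBl/= ler_norml; apply/andP; split.
  rewrite lerNl -ReN -linearNl -de; apply: Re_inner_le => //.
  by rewrite normrN.
by rewrite -de; exact: Re_inner_le.
Qed.

Lemma scalar_measure_semi_sigma_additive : semi_sigma_additive mu.
Proof.
move=> F mF tF mUF; rewrite [X in _ --> X]/scalar_measure asboolT//.
have -> : (fun n => \sum_(0 <= i < n) mu (F i))%E =
    EFin \o (fun n => complex.Re (inner (\sum_(0 <= i < n) E (F i) x) x)).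
  apply/funext => n /=.
  rewrite linear_sumlz /= (big_morph _ ReD erefl) -sumEFin.
  by apply: eq_bigr => i _; rewrite /scalar_measure asboolT.
apply: cvg_EFin; first exact: nearW.
exact: Re_inner_cvg (@proj_sigma_additive _ E F mF tF x).
Qed.

HB.instance Definition _ := isMeasure.Build _ _ _ mu
  scalar_measure0 scalar_measure_ge0 scalar_measure_semi_sigma_additive.

End scalar_measure_is_measure.

(* [A] is the integral of the identity with respect to [E], in the weak sense;
   the spectral measure of a bounded operator lives on a bounded interval. *)
Definition is_spectral_measure_of (H : hilbertType R) (A : H -> H)
    (E : projection_measure H) :=
  (exists M : R, forall x, E `[- M, M]%classic x = x) /\
  (forall x, inner (A x) x =
     (\int[scalar_measure E x]_(l in [set: RR]) (l : R))%:C).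

Definition maximal_spectral_type (H : hilbertType R)
    (E : projection_measure H) (x : H) :=
  forall y : H, scalar_measure E y `<< scalar_measure E x.

Definition mutually_singular (mu nu : {measure set RR -> \bar R}) :=
  exists N : set RR, [/\ measurable N, mu N = 0%E & nu (~` N) = 0%E].

Definition radon_measure (mu : {measure set RR -> \bar R}) :=
  (forall K : set R, compact K -> (mu K < +oo)%E) /\
  (forall B : set RR, measurable B ->
     mu B = ereal_sup [set mu K | K in [set K : set R | compact K /\ K `<=` B]]).

End spectral_measures.

Section hausdorff.
Context {R : realType} {n : nat}.
Implicit Types (x y : 'rV[R]_n) (U X : set 'rV[R]_n).

(* The norm of the library on row vectors is the sup norm. *)
Definition euclidean_norm x : R := Num.sqrt (\sum_(k < n) x 0 k ^+ 2).

Definition unit_sphere : set 'rV[R]_n := [set x | euclidean_norm x = 1].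

Definition diameter U : \bar R :=
  ereal_sup [set (euclidean_norm (x - y))%:E | x in U & y in U].

(* The empty set contributes 0 and a singleton contributes 0^0 = 1 when s = 0,
   so that the 0-dimensional measure is the counting measure. *)
Definition diameter_pow (s : R) U : \bar R :=
  if U == set0 then 0%E else poweR (diameter U) s.

Definition hausdorff_content (s delta : R) X : \bar R :=
  ereal_inf [set (\sum_(0 <= i <oo) diameter_pow s (U i))%E |
    U in [set U : (set 'rV[R]_n)^nat |
      X `<=` \bigcup_i U i /\ forall i, (diameter (U i) <= delta%:E)%E]].

Definition hausdorff_measure (s : R) X : \bar R :=
  ereal_sup [set hausdorff_content s delta X | delta in [set d : R | 0 < d]].

Definition hausdorff_dim X : \bar R :=
  ereal_inf [set s%:E | s in [set s : R | 0 <= s /\ hausdorff_measure s X = 0%E]].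

(* Up to a constant factor the surface measure of the sphere is the restriction
   of the (n-1)-dimensional Hausdorff measure. *)
Definition positive_surface_measure (D : set 'rV[R]_n) :=
  [/\ D `<=` unit_sphere,
      caratheodory_measurable (hausdorff_measure n.-1%:R) D &
      (0 < hausdorff_measure n.-1%:R D)%E].

End hausdorff.

Section perturbations.
Context {R : realType} {H : hilbertType R} {n : nat}.

Definition combination (K : 'I_n -> H -> H) (t : 'rV[R]_n) : H -> H :=
  fun x => \sum_(k < n) (t 0 k)%:C *: K k x.

Definition perturbation (A : H -> H) (K : 'I_n -> H -> H) (t : 'rV[R]_n) :
    H -> H :=
  fun x => A x + combination K t x.

End perturbations.

(* Main.v *)
(* Write [t = sum_j q_j tau_j] with [tau_0, ..., tau_(n-1)] spanning R^n, every
   [K_(tau_j)] non-negative and [K_(tau_j) <= K := K_(tau_0)]: [D] contains n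
   independent directions, since the sphere meets a hyperplane in a set of zero
   (n-1)-dimensional measure, and [tau_0] is taken to be their sum.

   If the spectral measure of [A_t] is not singular with respect to [sigma],
   then by cyclicity the measure [mu] of some vector [v = K_(tau_j) w] dominates
   [sigma / a] on a Lebesgue null compact set [G] with [sigma G >= 1 / a], and
   [w] may be taken in a countable dense set.  Cut the line into intervals [I] of
   length [eps], let [u = E(I) v], which satisfies [|(A_t - x) u| <= eps |u|]
   for the end point [x] of [I], and normalize it to [p] with
   [|p|^2 = 1 / sigma (I)] (here [sigma] is restricted to [G]).  As the unit
   vectors [u / |u|] are orthonormal and [K] is of trace class, [<K p, p>] stays
   bounded for most [I] in the sense of [sigma], while [<p, v>] is bounded below.
   As [G] is null, [sigma (I) / eps] exceeds any prescribed bound for most [I]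
   when [eps] is small.

   Now take two exceptional parameters [t], [t'].  At the same interval,
   self-adjointness gives [|<K_(t - t') p, p'>| <= 2 eps / sigma (I)], which is
   as small as we please.  If [t - t'] is nearly parallel to [tau_0], then [p]
   and [p'] are nearly orthogonal for the form of [K]; as each has a fixed
   correlation with [v], only boundedly many such parameters can share an
   interval.  So at most [C L^(n-1)] cells of a grid of mesh [1 / L] are involved
   at each interval, and integrating over [sigma] the same holds for the cells
   that meet the set of exceptional parameters with fixed [j], [w], [a]. *)

Require Import Defs.
From mathcomp Require Import all_boot all_order all_algebra.
From mathcomp Require Import ring lra complex zify.
From mathcomp Require Import all_classical all_reals all_analysis.
From mathcomp Require Import measurable_realfun.

Set Implicit Arguments.
Unset Strict Implicit.
Unset Printing Implicit Defensive.

Import Order.TTheory GRing.Theory Num.Theory.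
Import numFieldNormedType.Exports.

Local Open Scope classical_set_scope.
Local Open Scope ring_scope.

(** * The real inner product *)

Section real_inner_product.
Context {R : realType} {H : hilbertType R}.
Implicit Types (x y z : H) (r : R).
Local Open Scope complex_scope.

(** Taking real parts turns [H] into a real Hilbert space with the same norm; the quantitative
    argument only compares real symmetric forms on it. *)
Definition rip (x y : H) : R := complex.Re (inner x y).

Lemma ripC x y : rip x y = rip y x.
Proof. exact: Re_innerC. Qed.

Lemma ripDl x y z : rip (x + y) z = rip x z + rip y z.
Proof. by rewrite /rip linearDl /= ReD. Qed.

Lemma ripZl r x y : rip (r%:C *: x) y = r * rip x y.
Proof. by rewrite /rip linearZl_LR /= ReZ. Qed.

Lemma ripNl x y : rip (- x) y = - rip x y.
Proof. by rewrite /rip linearNl /= ReN. Qed.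

Lemma ripBl x y z : rip (x - y) z = rip x z - rip y z.
Proof. by rewrite ripDl ripNl. Qed.

Lemma rip0l y : rip 0 y = 0.
Proof. by rewrite /rip linear0l. Qed.

Lemma ripDr x y z : rip x (y + z) = rip x y + rip x z.
Proof. by rewrite ripC ripDl !(ripC _ x). Qed.

Lemma ripZr r x y : rip x (r%:C *: y) = r * rip x y.
Proof. by rewrite ripC ripZl ripC. Qed.

Lemma ripNr x y : rip x (- y) = - rip x y.
Proof. by rewrite ripC ripNl ripC. Qed.

Lemma ripBr x y z : rip x (y - z) = rip x y - rip x z.
Proof. by rewrite ripDr ripNr. Qed.

Lemma rip0r x : rip x 0 = 0.
Proof. by rewrite ripC rip0l. Qed.

Lemma rip_suml (I : Type) (s : seq I) (P : pred I) (F : I -> H) y :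
  rip (\sum_(i <- s | P i) F i) y = \sum_(i <- s | P i) rip (F i) y.
Proof. by apply: (big_morph (rip^~ y)) => [? ?|]; rewrite ?ripDl ?rip0l. Qed.

Lemma rip_sumr (I : Type) (s : seq I) (P : pred I) (F : I -> H) y :
  rip y (\sum_(i <- s | P i) F i) = \sum_(i <- s | P i) rip y (F i).
Proof. by rewrite ripC rip_suml; apply: eq_bigr => i _; rewrite ripC. Qed.

Lemma rip_ge0 x : 0 <= rip x x.
Proof. exact: Re_inner_ge0. Qed.

Lemma normE x : `|x| = (Num.sqrt (rip x x))%:C.
Proof.
have h : (rip x x)%:C = `|x| ^+ 2.
  rewrite -inner_norm /rip; apply/eqP; rewrite eq_complex /= eqxx /=.
  have : 0 <= inner x x by rewrite inner_norm exprn_ge0.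
  by rewrite lecE => /andP[/eqP h _]; rewrite eq_sym h.
apply/eqP; rewrite -(@eqrXn2 _ 2) //; last by rewrite ler0c sqrtr_ge0.
by rewrite -h -rmorphXn /= sqr_sqrtr // rip_ge0.
Qed.

Lemma rip_eq0 x : (rip x x == 0) = (x == 0).
Proof.
rewrite -[RHS]normr_eq0 normE; apply/eqP/eqP => [->|]; first by rewrite sqrtr0.
by move=> /(congr1 (@complex.Re _)) /= /eqP; rewrite sqrtr_eq0 => h;
  apply/le_anti; rewrite h rip_ge0.
Qed.

Lemma rip_all0 x : (forall y, rip x y = 0) -> x = 0.
Proof. by move=> h; apply/eqP; rewrite -rip_eq0 h. Qed.

Lemma norm_ltP x r : 0 < r -> (`|x| < r%:C) = (rip x x < r ^+ 2).
Proof.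
move=> r0; rewrite normE ltcR -[in RHS](sqr_sqrtr (rip_ge0 x)).
by rewrite ltr_pXn2r // ?nnegrE ?sqrtr_ge0 ?ltW.
Qed.

Lemma pos_complex (e : R[i]) : 0 < e -> exists2 r : R, 0 < r & e = r%:C.
Proof.
case: e => a b; rewrite ltcE /= => /andP[/eqP -> a0]; exists a => //.
Qed.

Lemma rip_sqrD x y : rip (x + y) (x + y) = rip x x + 2 * rip x y + rip y y.
Proof. by rewrite !ripDl !ripDr (ripC y x); ring. Qed.

Lemma rip_sqrB x y : rip (x - y) (x - y) = rip x x - 2 * rip x y + rip y y.
Proof. by rewrite !ripBl !ripBr (ripC y x); ring. Qed.

(** Degenerate forms are allowed on purpose: the main examples are [<K_tau x, y>] and [<|T| x, y>],
    which may vanish on large subspaces. *)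
Definition psd_form (f : H -> H -> R) :=
  [/\ forall x y z, f (x + y) z = f x z + f y z,
      forall r x y, f (r%:C *: x) y = r * f x y,
      forall x y, f x y = f y x &
      forall x, 0 <= f x x].

Lemma rip_psd : psd_form rip.
Proof.
by split; [exact: ripDl|exact: ripZl|exact: ripC|exact: rip_ge0].
Qed.

(** Evaluate the quadratic polynomial at its minimum [- b / c]; for [c = 0] an affine function that
    stays non-negative is constant. *)
Lemma discriminant (a b c : R) : 0 <= c ->
  (forall s, 0 <= a + 2 * s * b + s ^+ 2 * c) -> b ^+ 2 <= a * c.
Proof.
move=> c0 h; have [c00|cn0] := eqVneq c 0.
  have [->|bn0] := eqVneq b 0; first by rewrite c00; lra.
  have := h (- (a + 1) / (2 * b)); rewrite c00 mulr0 addr0.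
  have -> : 2 * (- (a + 1) / (2 * b)) * b = - (a + 1) by field.
  lra.
have cp : 0 < c by rewrite lt_neqAle eq_sym cn0.
have := h (- b / c).
have -> : a + 2 * (- b / c) * b + (- b / c) ^+ 2 * c = (a * c - b ^+ 2) / c.
  by field.
by rewrite pmulr_lge0 ?invr_gt0 // subr_ge0.
Qed.

Lemma psd_form_CS f x y : psd_form f -> f x y ^+ 2 <= f x x * f y y.
Proof.
move=> [fD fZ fC f0]; apply: discriminant => // s.
have := f0 (x + s%:C *: y).
rewrite fD !(fC _ (x + _)) !fD !fZ !(fC _ (s%:C *: _)) !fZ (fC y x) => h.
by apply: le_trans h _; rewrite le_eqVlt; apply/orP; left; apply/eqP; ring.
Qed.

Lemma rip_CS x y : rip x y ^+ 2 <= rip x x * rip y y.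
Proof. exact: psd_form_CS rip_psd. Qed.

End real_inner_product.

(** * Completeness and density of subspaces *)

Section hilbert_space.
Context {R : realType} {H : hilbertType R}.
Implicit Types (x y z : H) (r : R).
Local Open Scope complex_scope.

Lemma rip_cvgP (u : H^nat) x : u @ \oo --> x <->
  forall e : R, 0 < e -> exists N, forall k, (N <= k)%N ->
    rip (x - u k) (x - u k) < e.
Proof.
split=> [/cvgrPdist_lt h e e0|h].
  have s0 : 0 < Num.sqrt e by rewrite sqrtr_gt0.
  have /h [N _ hN] : 0 < (Num.sqrt e)%:C :> R[i] by rewrite ltcR.
  exists N => k Nk; have := hN k Nk; rewrite norm_ltP // sqr_sqrtr //;
    exact: ltW.
apply/cvgrPdist_lt => e /pos_complex [r r0 ->].
have /h [N hN] : 0 < r ^+ 2 by rewrite exprn_gt0.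
by exists N => // k Nk; rewrite norm_ltP //; exact: hN.
Qed.

Lemma rip_complete (u : H^nat) :
  (forall e : R, 0 < e -> exists N, forall k l, (N <= k)%N -> (N <= l)%N ->
    rip (u k - u l) (u k - u l) < e) ->
  exists x, u @ \oo --> x.
Proof.
move=> h; have : cvg (u @ \oo).
  apply: cauchy_cvg; apply: cauchy_exP => e /pos_complex [r r0 ->].
  have /h [N hN] : 0 < r ^+ 2 by rewrite exprn_gt0.
  exists (u N); exists N => // k Nk.
  by rewrite -ball_normE /= norm_ltP //; exact: hN.
by move=> cu; exists (lim (u @ \oo)).
Qed.

(** A sequence in [W] minimizing the distance to [y] is Cauchy. Its limit [v] leaves [y - v]
    orthogonal to [W], so [y = v] is a limit of points of [W]. Only real scalars are needed. *)
Lemma dense_of_trivial_orthogonal (W : set H) :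
  W 0 -> (forall x y, W x -> W y -> W (x + y)) ->
  (forall r x, W x -> W (r%:C *: x)) ->
  (forall x, (forall w, W w -> rip x w = 0) -> x = 0) ->
  forall y (e : R), 0 < e -> exists2 w, W w & rip (y - w) (y - w) < e.
Proof.
move=> W0 WD WZ Wperp y.
pose S := [set rip (y - w) (y - w) | w in W].
have Slb : has_lbound S by exists 0 => _ [w _ <-]; exact: rip_ge0.
have S0 : S !=set0 by exists (rip (y - 0) (y - 0)), 0.
have Sinf : has_inf S by split.
have /choice [u hu] : forall k : nat, exists w,
    W w /\ rip (y - w) (y - w) < inf S + k.+1%:R^-1.
  move=> k; have k0 : 0 < k.+1%:R^-1 :> R by rewrite invr_gt0.
  by have [_ [w Ww <-] lt] := inf_adherent k0 Sinf; exists w.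
have infS w : W w -> inf S <= rip (y - w) (y - w).
  by move=> Ww; apply: ge_inf => //; exists w.
(* The midpoint of [u k] and [u l] lies in [W], so its squared distance to [y] is at least
   [inf S]. *)
have parallelogram k l : rip (u k - u l) (u k - u l) <=
    2 * (k.+1%:R^-1 + l.+1%:R^-1).
  have := infS ((2^-1)%:C *: (u k + u l)) (WZ _ _ (WD _ _ (hu k).1 (hu l).1)).
  have := (hu k).2; have := (hu l).2.
  rewrite !rip_sqrB !ripZr !ripZl !ripDr !ripDl (ripC (u l) (u k)).
  move: (inf S) (k.+1%:R^-1) (l.+1%:R^-1) => a b c; lra.
have [|v uv] := @rip_complete u.
  move=> e e0; have e40 : 0 < e / 4 by rewrite divr_gt0.
  have [N _ hN] := near_infty_natSinv_lt (PosNum e40).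
  exists N => k l Nk Nl; apply: le_lt_trans (parallelogram k l) _.
  have hk : k.+1%:R^-1 < e / 4 := hN k Nk.
  have hl : l.+1%:R^-1 < e / 4 := hN l Nl.
  by move: (k.+1%:R^-1) (l.+1%:R^-1) hk hl => b c; lra.
suff yv : y = v.
  move=> e e0; move/rip_cvgP: uv => /(_ e e0) [N hN].
  by exists (u N); [exact: (hu N).1|rewrite yv; exact: hN].
apply/eqP; rewrite -subr_eq0; apply/eqP; apply: Wperp => w Ww.
(* Moving [u k] along [w] cannot bring the squared distance below [inf S], and [u k] is within
   [1 / k.+1] of it; the discriminant of this quadratic in [s] measures how far [y - u k] is from
   orthogonal to [w]. *)
have ineq k : rip (y - u k) w ^+ 2 <= k.+1%:R^-1 * rip w w.
  apply: discriminant; first exact: rip_ge0.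
  move=> s; have Ws : W (u k + (- s)%:C *: w) by apply: WD (hu k).1 (WZ _ _ Ww).
  have := infS _ Ws; have := (hu k).2.
  have -> : y - (u k + (- s)%:C *: w) = (y - u k) + s%:C *: w.
    by rewrite opprD addrA rmorphN scaleNr opprK.
  rewrite (rip_sqrD (y - u k)) !ripZr ripZl.
  by move: (inf S) (k.+1%:R^-1) => a b; lra.
apply/eqP; rewrite -sqrf_eq0; apply/eqP/le_anti; rewrite sqr_ge0 andbT.
apply/ler_addgt0Pr => e e0; rewrite add0r.
have c0 : 0 < 1 + rip w w by rewrite ltr_pwDl // rip_ge0.
have [d d0 dE] : exists2 d : R, 0 < d & d * (1 + rip w w) = e / 4.
  exists (e / (4 * (1 + rip w w))); first by rewrite divr_gt0 // mulr_gt0.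
  by field; rewrite gt_eqF.
have [N1 _ hN1] := near_infty_natSinv_lt (PosNum d0).
move/rip_cvgP: uv => /(_ d d0) [N2 hN2].
pose k := maxn N1 N2.
have h1 : k.+1%:R^-1 < d by apply: (hN1 k); exact: leq_maxl.
have h2 := hN2 k (leq_maxr _ _).
have h3 := rip_CS (v - u k) w.
have -> : y - v = (y - u k) - (v - u k) by rewrite opprB addrA subrK.
rewrite ripBl.
have w0 := rip_ge0 w.
have h4 := ineq k.
have h5 : k.+1%:R^-1 * rip w w <= d * rip w w by rewrite ler_wpM2r // ltW.
have h6 : rip (v - u k) (v - u k) * rip w w <= d * rip w w.
  by rewrite ler_wpM2r // ltW.
have h7 := le_trans h4 h5; have h8 := le_trans h3 h6.
rewrite mulrDr mulr1 in dE.
have h9 : 0 <= (rip (y - u k) w + rip (v - u k) w) ^+ 2 by exact: sqr_ge0.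
move: (rip (y - u k) w) (rip (v - u k) w) (d * rip w w) dE h7 h8 h9.
by move=> p q c; lra.
Qed.

End hilbert_space.

(** * Trace class operators *)

Section orthonormal_systems.
Context {R : realType} {H : hilbertType R}.
Implicit Types (x y z : H) (r : R).
Local Open Scope complex_scope.

Lemma le_sum_uniq_subset (T : eqType) (s t : seq T) (F : T -> R) :
  uniq s -> {subset s <= t} -> (forall x : T, 0 <= F x) ->
  \sum_(x <- s) F x <= \sum_(x <- t) F x.
Proof.
elim: s t => [|x s IH] t /=; first by rewrite big_nil => *; exact: sumr_ge0.
move=> /andP[xs us] st F0; have xt : x \in t by apply: st; rewrite mem_head.
rewrite big_cons (perm_big _ (perm_to_rem xt)) big_cons lerD2l.
apply: IH => // y ys; have := st y; rewrite inE ys orbT => /(_ isT).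
rewrite (perm_mem (perm_to_rem xt)) inE => /predU1P[yx|//].
by rewrite -yx ys in xs.
Qed.

Lemma psd_suml (f : H -> H -> R) : psd_form f ->
  forall (I : Type) (s : seq I) (P : pred I) (c : I -> R) (F : I -> H) y,
  f (\sum_(i <- s | P i) (c i)%:C *: F i) y =
  \sum_(i <- s | P i) c i * f (F i) y.
Proof.
move=> [fD fZ fC f0] I s P c F y.
have f0y : f 0 y = 0 by rewrite -(scale0r 0) (fZ 0) mul0r.
rewrite (big_morph (f^~ y) (fun a b => fD a b y) f0y).
by apply: eq_bigr => i _; rewrite fZ.
Qed.

Lemma psdN (f : H -> H -> R) : psd_form f -> forall x y, f (- x) y = - f x y.
Proof. by move=> [_ fZ _ _] x y;
  rewrite -scaleN1r -(rmorphN1 (real_complex R)) fZ mulN1r. Qed.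

Lemma bessel (f : H -> H -> R) (I : finType) (e : I -> H) x : psd_form f ->
  (forall i j, i != j -> f (e i) (e j) = 0) -> (forall i, f (e i) (e i) <= 1) ->
  \sum_i f (e i) x ^+ 2 <= f x x.
Proof.
move=> pf e0 e1; have [fD fZ fC f0] := pf.
pose z := \sum_i (f (e i) x)%:C *: e i.
have zx : f z x = \sum_i f (e i) x ^+ 2.
  by rewrite psd_suml //; apply: eq_bigr => i _; rewrite expr2.
have zz : f z z <= \sum_i f (e i) x ^+ 2.
  rewrite {1}/z psd_suml //; apply: ler_sum => i _.
  rewrite (fC _ z) psd_suml // (bigD1 i) //= big1 => [|j ji].
    by rewrite addr0 mulrA -expr2 ler_piMr ?sqr_ge0.
  by rewrite e0 // mulr0.
have := f0 (x - z); rewrite fD !(fC _ (x - z)) !fD !psdN // !(fC _ (- z)).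
rewrite !psdN // zx ?(fC x z) ?zx; lra.
Qed.

(* The vectors [g l] are the Gram-Schmidt orthonormalization of [s] for the
   degenerate form [f]; they serve as a substitute for the square root of the
   operator defining [f]. *)
Lemma gram_schmidt (f : H -> H -> R) (s : seq H) : psd_form f ->
  exists m (g : 'I_m -> H), (forall k l, f (g k) (g l) = (k == l)%:R) /\
    forall x, x \in s ->
      let r := x - \sum_l (f x (g l))%:C *: g l in f r r = 0.
Proof.
move=> pf; have [fD fZ fC f0] := pf.
elim: s => [|x s [m [g [gg gs]]]].
  by exists 0%N, (fun=> 0); split => [[]|].
pose r := x - \sum_l (f x (g l))%:C *: g l.
have rg l : f r (g l) = 0.
  rewrite fD psdN // psd_suml // (bigD1 l) //= big1 => [|k kl].
    by rewrite gg eqxx mulr1 addr0 subrr.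
  by rewrite gg (negbTE kl) mulr0.
have [r0|rn0] := eqVneq (f r r) 0.
  exists m, g; split => // y; rewrite inE => /predU1P[->//|]; exact: gs.
have rp : 0 < f r r by rewrite lt_neqAle eq_sym rn0 f0.
pose a := (Num.sqrt (f r r))^-1.
pose g' := fun i : 'I_m.+1 => oapp g (a%:C *: r) (unlift ord0 i).
have g'0 : g' ord0 = a%:C *: r by rewrite /g' unlift_none.
have g'S (k : 'I_m) : g' (lift ord0 k) = g k by rewrite /g' liftK.
have g'g' k l : f (g' k) (g' l) = (k == l)%:R.
  case: (unliftP ord0 k) => [k' ->|->]; case: (unliftP ord0 l) => [l' ->|->];
    rewrite ?g'S ?g'0.
  - by rewrite gg (inj_eq lift_inj).
  - by rewrite fC fZ rg mulr0.
  - by rewrite fZ rg mulr0.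
  - rewrite fZ fC fZ mulrA -expr2 exprVn sqr_sqrtr ?f0 // mulVf //.
have fyr y : f y r = f (y - \sum_l (f y (g l))%:C *: g l) r.
  rewrite fD psdN // psd_suml // big1 ?subr0 // => l _.
  by rewrite (fC _ r) rg mulr0.
exists m.+1, g'; split => // y; rewrite inE => ys /=.
rewrite big_ord_recl g'0 fC fZ fC fyr.
under [X in _ *: _ + X]eq_bigr do rewrite g'S.
rewrite opprD addrCA.
have [->|yx] := eqVneq y x.
  rewrite -/r scalerA -rmorphM mulrAC -expr2 exprVn sqr_sqrtr ?f0 // mulVf //.
  by rewrite scale1r addNr; have := fD 0 0 0; rewrite addr0; lra.
have {}ys : y \in s by move: ys; rewrite (negbTE yx).
have := gs _ ys; move: (y - _) => q q0.
(* A null vector of the form is orthogonal to everything, by Cauchy-Schwarz. *)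
have -> : f q r = 0.
  by have := psd_form_CS q r pf; rewrite q0 mul0r; have := sqr_ge0 (f q r); nra.
by rewrite mulr0 scale0r oppr0 add0r.
Qed.

End orthonormal_systems.

Section trace.
Context {R : realType} {H : hilbertType R}.
Implicit Types (x y z : H) (r : R).
Local Open Scope complex_scope.

(** [W] consists of the vectors in the double orthogonal complement of a finite part of [B]; it is
    dense because [B] is maximal. If [w] in [W] is close to [x], the projection [z] of [x] on the
    corresponding finite part loses little, since [x - z] is orthogonal to [w]. *)
Lemma parseval_seq (B : set H) x (e : R) :
  (forall b c, B b -> B c -> rip b c = (b == c)%:R) ->
  (forall y, (forall b, B b -> rip y b = 0) -> y = 0) -> 0 < e ->
  exists F : seq H, [/\ uniq F, forall b, b \in F -> B b &
    rip x x <= \sum_(b <- F) rip x b ^+ 2 + e].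
Proof.
move=> Bon Bmax e0.
pose W := [set z | exists F : seq H, [/\ uniq F, forall b, b \in F -> B b &
  forall y, (forall b, b \in F -> rip y b = 0) -> rip y z = 0]].
have c0 : 0 < 1 + rip x x by rewrite ltr_pwDl // rip_ge0.
have Wdense : forall d, 0 < d -> exists2 w, W w & rip (x - w) (x - w) < d.
  apply: dense_of_trivial_orthogonal.
  - by exists [::]; split => // y _; rewrite rip0r.
  - move=> y z [F [uF FB Fy]] [G [uG GB Gz]]; exists (undup (F ++ G)); split.
    + exact: undup_uniq.
    + by move=> b; rewrite mem_undup mem_cat => /orP[/FB|/GB].
    + move=> t tFG; rewrite ripDr Fy ?Gz ?addr0 // => b bF; apply: tFG;
        by rewrite mem_undup mem_cat bF ?orbT.
  - move=> r z [F [uF FB Fz]]; exists F; split => // y yF.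
    by rewrite ripZr Fz // mulr0.
  - move=> y yW; apply: Bmax => b Bb; apply: yW; exists [:: b]; split => //.
      by move=> c; rewrite inE => /eqP ->.
    by move=> t; apply; rewrite mem_head.
(* With this accuracy Cauchy-Schwarz bounds the defect [rip (x - z) (x - w)] by [e]. *)
have d0 : 0 < e ^+ 2 / (1 + rip x x) by rewrite divr_gt0 // exprn_gt0.
have [w [F [uF FB Fw]] xw] := Wdense _ d0.
exists F; split => //.
pose z := \sum_(b <- F) (rip x b)%:C *: b.
have zb b : b \in F -> rip z b = rip x b.
  move=> bF; rewrite /z (psd_suml (@rip_psd R H)) (bigD1_seq b) //=.
  rewrite big1_seq ?addr0.
    by rewrite (Bon b b) ?eqxx ?mulr1 //; exact: FB.
  move=> c /andP[cb cF]; rewrite (Bon c b) ?(negbTE cb) ?mulr0 //; exact: FB.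
have zx : rip z x = \sum_(b <- F) rip x b ^+ 2.
  rewrite /z (psd_suml (@rip_psd R H)); apply: eq_bigr => b _.
  by rewrite expr2 (ripC b).
have zz : rip z z = \sum_(b <- F) rip x b ^+ 2.
  rewrite {1}/z (psd_suml (@rip_psd R H)); apply: eq_big_seq => b bF.
  by rewrite (ripC b) zb // expr2.
have xzw : rip (x - z) w = 0.
  by apply: Fw => b bF; rewrite ripBl zb // subrr.
have E1 : rip x x - \sum_(b <- F) rip x b ^+ 2 = rip (x - z) (x - w).
  by rewrite ripBr xzw subr0 ripBl zx.
have E2 : rip (x - z) (x - z) <= rip x x.
  by rewrite rip_sqrB (ripC x z) zx zz; have := rip_ge0 z; rewrite zz; lra.
have E3 := rip_CS (x - z) (x - w).
suff : rip (x - z) (x - w) <= e by rewrite -E1; lra.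
rewrite leNgt; apply/negP => eL.
have : e ^+ 2 < rip (x - z) (x - w) ^+ 2 by rewrite ltr_pXn2r ?nnegrE // ltW //
  (lt_trans e0).
apply/negP; rewrite -leNgt; apply: le_trans E3 _.
have -> : e ^+ 2 = (1 + rip x x) * (e ^+ 2 / (1 + rip x x)).
  by field; rewrite gt_eqF.
apply: ler_pM; rewrite ?rip_ge0 ?ltW //.
by apply: le_lt_trans E2 _; rewrite ltrDr.
Qed.

Lemma rip_complexi x y : rip ('i *: x) y = - rip x ('i *: y).
Proof.
rewrite /rip linearZl_LR linearZ_LR /=; case: (inner x y) => a b /=.
by ring.
Qed.

(** Polarization: the imaginary part of [<P z, z>] vanishes at [z = x + i y], [z = x] and [z = y],
    and the cross terms that remain are the two sides. *)
Lemma nonneg_op_sym (P : {linear H -> H}) : nonneg_op P ->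
  forall x y, rip (P x) y = rip (P y) x.
Proof.
move=> P0 x y.
have Im0 z : complex.Im (inner (P z) z) = 0.
  by have := P0 z; rewrite lecE => /andP[/eqP ->].
have h := Im0 (x + 'i *: y).
rewrite (linearD P) (linearZ_LR P) linearDl /= !linearDr /= !linearZ_LR /=
  !linearZl_LR /= in h.
have hx := Im0 x; have hy := Im0 y.
rewrite /rip; move: h hx hy => /=.
case: (inner (P x) x) => a1 a2; case: (inner (P y) y) => b1 b2.
case: (inner (P x) y) => c1 c2; case: (inner (P y) x) => d1 d2 /=.
lra.
Qed.

(** Let [f] be the form of [|T|] and orthonormalize the [e i] for [f] into [g]. Expanding [T (e i)]
    in the [T (g l)], then using the arithmetic-geometric mean and Bessel, bounds the sum by that of
    the [|P (g l)|^2]. Parseval in the basis and Bessel for [f] bound the latter by the trace. *)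
Lemma trace_class_bound (T : {linear H -> H}) : trace_class T ->
  exists C : R, forall (I : finType) (e : I -> H),
    (forall i j, i != j -> rip (e i) (e j) = 0) ->
    (forall i, rip (e i) (e i) <= 1) ->
    \sum_i `|rip (T (e i)) (e i)| <= C.
Proof.
move=> [_ [P [B [[_ P0 PT] [Bon Bmax] Btr]]]].
pose f x y := rip (P x) y.
have pf : psd_form f.
  split => [x y z|r x y|x y|x].
  - by rewrite /f raddfD ripDl.
  - by rewrite /f linearZ ripZl.
  - exact: nonneg_op_sym.
  - by have := P0 x; rewrite lecE => /andP[].
have PT' x : rip (P x) (P x) = rip (T x) (T x).
  rewrite /rip -PT -[LHS]/(f x (P x)) -[RHS]/(f (P x) x).
  by have [_ _ -> _] := pf.
pose t := fine (\esum_(b in B) (f b b)%:E).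
have f0 b : 0 <= f b b by have [_ _ _] := pf.
have tr_le (F : seq H) : uniq F -> (forall b, b \in F -> B b) ->
    \sum_(b <- F) f b b <= t.
  move=> uF FB.
  have fin : \esum_(b in B) (f b b)%:E \is a fin_num.
    rewrite ge0_fin_numE //; apply: esum_ge0 => b _; by rewrite lee_fin.
  rewrite -lee_fin fineK // -sumEFin; apply: esum_ge; exists [set` F].
    by split; [exact: finite_seq|move=> b /FB].
  by rewrite -fsbig_seq.
(* Over the reals an orthonormal basis is made of [B] and [i B]. Both halves have the same trace,
   whence the factor 2. *)
pose B' := B `|` [set 'i *: b | b in B].
exists (2 * t) => I e e_orth e_le1.
have [m [g [gg gs]]] := gram_schmidt [seq e i | i : I] pf.
(* The residual is null for [f], so [|T|] kills it, and so does [T] because [|T q|] and [|P q|]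
   agree. *)
have Tr i : T (e i - \sum_l (f (e i) (g l))%:C *: g l) = 0.
  have := gs (e i) (map_f _ (mem_enum _ i)) => /=.
  move: (e i - _) => q q0; apply/eqP; rewrite -rip_eq0 -PT' rip_eq0.
  apply/eqP; apply: rip_all0 => y.
  have := psd_form_CS q y pf; rewrite q0 mul0r /f => h.
  by apply/eqP; rewrite -sqrf_eq0; apply/eqP/le_anti; rewrite h sqr_ge0.
have Te i : T (e i) = \sum_l (f (e i) (g l))%:C *: T (g l).
  have := Tr i; rewrite raddfB raddf_sum /= => /eqP;
    rewrite subr_eq0 => /eqP ->.
  by apply: eq_bigr => l _; rewrite linearZ.
have sum_le : \sum_i `|rip (T (e i)) (e i)| <= \sum_l rip (P (g l)) (P (g l)).
  have E i : `|rip (T (e i)) (e i)| <=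
      \sum_l (rip (e i) (P (g l)) ^+ 2 + rip (e i) (T (g l)) ^+ 2) / 2.
    rewrite Te (psd_suml (@rip_psd R H));
      apply: le_trans (ler_norm_sum _ _ _) _.
    apply: ler_sum => l _; rewrite normrM /f nonneg_op_sym //.
    rewrite !(ripC _ (e i)).
    move: (rip (e i) _) (rip (e i) _) => a b.
    have h : 0 <= (`|a| - `|b|) ^+ 2 by exact: sqr_ge0.
    rewrite sqrrB !real_normK ?num_real // in h; lra.
  apply: le_trans (ler_sum _ (fun i _ => E i)) _.
  rewrite exchange_big /=; apply: ler_sum => l _.
  rewrite -mulr_suml big_split /=.
  have := bessel (P (g l)) (@rip_psd R H) e_orth e_le1.
  have := bessel (T (g l)) (@rip_psd R H) e_orth e_le1.
  rewrite -PT'; lra.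
apply: le_trans sum_le _; apply/ler_addgt0Pr => d d0.
have dm0 : 0 < d / m.+1%:R by rewrite divr_gt0.
have rip_i x y : rip ('i *: x) ('i *: y) = rip x y.
  rewrite rip_complexi scalerA -expr2 sqr_i -(rmorphN1 (real_complex R)).
  by rewrite ripZr mulN1r opprK.
have fi x y : f ('i *: x) ('i *: y) = f x y by rewrite /f linearZ rip_i.
have B'on b c : B' b -> B' c -> rip b c = (b == c)%:R.
  have on b' c' : B b' -> B c' -> rip b' c' = (b' == c')%:R.
    by move=> Bb Bc; rewrite /rip Bon //; case: eqP.
  have oni b' c' : B b' -> B c' -> rip b' ('i *: c') = 0.
    move=> Bb Bc; rewrite /rip linearZ_LR /= Bon //.
    by case: eqP => _ /=; rewrite ?mulr0 ?mulr1 //=; ring.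
  have ne b' c' : B b' -> B c' -> (b' == 'i *: c') = false.
    move=> Bb Bc; apply/eqP => h; have := oni _ _ Bb Bc; rewrite -h on // eqxx.
    by move/eqP; rewrite oner_eq0.
  move=> [Bb|[b' Bb <-]] [Bc|[c' Bc <-]].
  - exact: on.
  - by rewrite oni // ne.
  - by rewrite ripC oni // eq_sym ne.
  - by rewrite rip_i on // (inj_eq (scalerI _)) // neq0Ci.
have B'max y : (forall b, B' b -> rip y b = 0) -> y = 0.
  move=> yB; apply: Bmax => b Bb; apply/eqP; rewrite eq_complex.
  have h1 := yB b (or_introl Bb).
  have := yB ('i *: b) (or_intror (ex_intro2 _ _ b Bb erefl)).
  rewrite /rip linearZ_LR /= in h1 *; move: h1.
  by case: (inner y b) => p q /=; rewrite !mul0r; lra.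
have /choice [F hF] : forall l : 'I_m, exists F : seq H,
    [/\ uniq F, forall b, b \in F -> B' b & rip (P (g l)) (P (g l)) <=
      \sum_(b <- F) rip (P (g l)) b ^+ 2 + d / m.+1%:R].
  by move=> l; exact: parseval_seq B'on B'max dm0.
pose G := undup (flatten [seq F l | l : 'I_m]).
have uG : uniq G by exact: undup_uniq.
have FG l : {subset F l <= G}.
  move=> b bF; rewrite mem_undup; apply/flatten_mapP; exists l => //.
  exact: mem_enum.
have GB' b : b \in G -> B' b.
  rewrite mem_undup => /flatten_mapP[l _ bF]; have [_ h _] := hF l; exact: h.
apply: (@le_trans _ _ (\sum_(b <- G) f b b + d)).
  have E l : rip (P (g l)) (P (g l)) <=
      \sum_(b <- G) f (g l) b ^+ 2 + d / m.+1%:R.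
    have [uF _ h] := hF l; apply: le_trans h _; rewrite lerD2r.
    by apply: le_sum_uniq_subset => // b; exact: sqr_ge0.
  apply: le_trans (ler_sum _ (fun l _ => E l)) _.
  rewrite big_split /= exchange_big /=; apply: lerD.
    (* Here Bessel is used for [f] itself: [rip (P (g l)) b] is the coefficient [f (g l) b] of the
       basis vector [b] in the [f]-orthonormal system [g]. *)
    apply: ler_sum => b _; apply: bessel => // i; last by rewrite gg eqxx.
    by move=> j ij; rewrite gg (negbTE ij).
  rewrite sumr_const card_ord -[leLHS]mulr_natr -mulrA ler_piMr ?(ltW d0) //.
  by rewrite mulrC ler_pdivrMr ?mul1r ?ler_nat.
rewrite lerD2r (bigID (fun b => `[< B b >])) /= mulr_natl mulr2n.
rewrite -!(big_filter G); apply: lerD.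
  apply: tr_le; first exact: filter_uniq.
  by move=> b; rewrite mem_filter => /andP[/asboolP].
(* Multiplication by [- i] carries the elements of [i B] back to [B] without changing [f b b]. *)
have -> : \sum_(b <- [seq b <- G | ~~ `[< B b >]]) f b b =
    \sum_(b <- [seq - 'i *: b | b <- [seq b <- G | ~~ `[< B b >]]]) f b b.
  rewrite big_map; apply: eq_bigr => b _.
  by rewrite scaleNr psdN // [f ('i *: b) _]nonneg_op_sym // -/(f _ _) psdN //
    opprK fi.
apply: tr_le.
  rewrite map_inj_uniq ?filter_uniq //; apply: scalerI.
  by rewrite oppr_eq0 neq0Ci.
move=> b /mapP[c]; rewrite mem_filter => /andP[/asboolPn nB /GB'].
move=> [//|[c' Bc' <-] ->].
by rewrite scalerA mulNr -expr2 sqr_i opprK scale1r.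
Qed.

End trace.

(** * Spectral measures *)

Section spectral.
Context {R : realType} {H : hilbertType R}.
Implicit Types (x y z : H) (r : R).
Local Open Scope complex_scope.
Local Notation RR := (measurableTypeR R).

Section projections.
Variable E : projection_measure H.
Implicit Types B C : set RR.

Lemma scalar_measureE B x : measurable B ->
  scalar_measure E x B = (rip (E B x) x)%:E.
Proof. by move=> mB; rewrite /scalar_measure asboolT. Qed.

Lemma proj_sym B x y : measurable B -> rip (E B x) y = rip x (E B y).
Proof. by move=> mB; rewrite /rip (proj_self_adjoint E mB). Qed.

Lemma proj_idem B x : measurable B -> E B (E B x) = E B x.
Proof. by move=> mB; rewrite -(projI E mB mB) setIid. Qed.

Lemma proj_rip B x : measurable B -> rip (E B x) x = rip (E B x) (E B x).
Proof. by move=> mB; rewrite -proj_sym // proj_idem. Qed.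

Lemma proj_disj B C x : measurable B -> measurable C -> B `&` C = set0 ->
  E B (E C x) = 0.
Proof. by move=> mB mC BC; rewrite -(projI E mB mC) BC proj0. Qed.

Lemma proj_ripD B C x : measurable B -> measurable C -> B `&` C = set0 ->
  rip (E (B `|` C) x) x = rip (E B x) x + rip (E C x) x.
Proof.
move=> mB mC BC.
have : scalar_measure E x (B `|` C) =
    (scalar_measure E x B + scalar_measure E x C)%E.
  exact: measureU.
rewrite !scalar_measureE //; last exact: measurableU.
by move=> [].
Qed.

Lemma proj_compl B x : measurable B -> E (~` B) x = x - E B x.
Proof.
move=> mB; have mC : measurable (~` B) by exact: measurableC.
apply/eqP; rewrite -subr_eq0 -rip_eq0; apply/eqP.
have := proj_ripD x mB mC (setICr _); rewrite setUv projT.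
have d : rip (E (~` B) x) (E B x) = 0.
  by rewrite proj_sym // (proj_disj x mC mB) ?rip0r // setICl.
have := proj_rip x mC; have := proj_rip x mB; move: d.
move: (E B x) (E (~` B) x) => p c d hp hc h.
rewrite !ripBl !ripBr (ripC x p) (ripC x c) (ripC p c); lra.
Qed.

Lemma scalar_measure_proj B C x : measurable B -> measurable C ->
  scalar_measure E (E B x) C = scalar_measure E x (B `&` C).
Proof.
move=> mB mC; rewrite !scalar_measureE //; last exact: measurableI.
rewrite -(proj_sym (E C (E B x)) x mB) -(projI E mB mC).
by rewrite -(projI E _ mB) -?setIA ?(setIC C) ?setIA ?setIid //;
  exact: measurableI.
Qed.

Lemma scalar_measure_le B x : measurable B ->
  (scalar_measure E x B <= (rip x x)%:E)%E.
Proof.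
move=> mB; rewrite scalar_measureE // lee_fin.
have := proj_ripD x mB (measurableC mB) (setICr _); rewrite setUv projT => ->.
by rewrite lerDl proj_rip ?rip_ge0 //; exact: measurableC.
Qed.

End projections.

Section carrier.
Variable mu : {measure set RR -> \bar R}.

Lemma Rintegral_carrier (B : set RR) (f : RR -> R) : measurable B ->
  mu.-integrable setT (EFin \o f) -> mu (~` B) = 0%E ->
  (\int[mu]_(x in setT) f x = \int[mu]_(x in B) f x)%R.
Proof.
move=> mB fi mu0; rewrite /Rintegral; congr fine.
rewrite (negligible_integral _ _ fi mu0) //; last exact: measurableC.
by rewrite setTD setCK.
Qed.

Lemma bounded_carrier_integrable (M : R) : (mu setT < +oo)%E ->
  mu (~` `[- M, M]%classic) = 0%E ->
  mu.-integrable setT (EFin \o (fun l : RR => l : R)).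
Proof.
move=> mufin mu0; set I := `[- M, M]%classic : set RR.
have mI : measurable I by exact: measurable_itv.
rewrite (negligible_integrable (measurableC mI)) //; last first.
  exact/measurable_EFinP.
rewrite setTD setCK; apply: measurable_bounded_integrable => //.
  by apply: le_lt_trans mufin; apply: le_measure; rewrite ?inE.
exists `|M|; split; first exact: num_real.
move=> r Mr l; rewrite /I /= in_itv /= => /andP[l1 l2].
apply: le_trans (ltW Mr); rewrite ler_norml; apply/andP; split.
  by apply: le_trans l1; rewrite lerN2 ler_norm.
by apply: le_trans l2 _; exact: ler_norm.
Qed.

End carrier.

Section spectral_measure.
Variables (T : H -> H) (E : projection_measure H).
Hypothesis TE : is_spectral_measure_of T E.
Hypothesis Tsym : forall x y, rip (T x) y = rip x (T y).
Local Notation quad x := (\int[scalar_measure E x]_(l in [set: RR]) (l : R))%R.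

Lemma symD x y : T (x + y) = T x + T y.
Proof.
apply/eqP; rewrite -subr_eq0; apply/eqP/rip_all0 => z.
by rewrite ripBl ripDl !Tsym ripDl subrr.
Qed.

Lemma symN x : T (- x) = - T x.
Proof.
apply/eqP; rewrite -subr_eq0; apply/eqP/rip_all0 => z.
by rewrite ripBl ripNl !Tsym ripNl subrr.
Qed.

Lemma quadE x : rip (T x) x = quad x.
Proof. by rewrite /rip TE.2. Qed.

Lemma spectral_integrable x :
  (scalar_measure E x).-integrable setT (EFin \o (fun l : RR => l : R)).
Proof.
have [[M hM] _] := TE; apply: (@bounded_carrier_integrable _ M).
  by apply: le_lt_trans (ltry (rip x x)); exact: scalar_measure_le.
have mI : measurable (`[- M, M]%classic : set RR) by exact: measurable_itv.
rewrite -[LHS]/(scalar_measure E x _) scalar_measureE; last exact: measurableC.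
by rewrite proj_compl // hM subrr rip0l.
Qed.

Lemma proj_carrier B x : measurable B ->
  scalar_measure E (E B x) (~` B) = 0%E.
Proof.
move=> mB; rewrite scalar_measure_proj //; last exact: measurableC.
by rewrite setICr measure0.
Qed.

Lemma quad_split B x : measurable B ->
  quad x = quad (E B x) + quad (E (~` B) x).
Proof.
move=> mB; have mC : measurable (~` B) by exact: measurableC.
have part C : measurable C -> quad (E C x) =
    (\int[scalar_measure E x]_(l in C) (l : R))%R.
  move=> {mB mC B} mC; rewrite (Rintegral_carrier mC (spectral_integrable _));
    last exact: proj_carrier.
  rewrite /Rintegral; congr fine; apply: eq_measure_integral => A mA AC.
  rewrite -[LHS]/(scalar_measure E (E C x) A) -[RHS]/(scalar_measure E x A).
  by rewrite scalar_measure_proj // setIC; congr (scalar_measure _ _ _);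
    apply/setIidPl.
rewrite !part // -Rintegral_setU ?setUv //.
  exact: spectral_integrable.
by rewrite /disj_set setICr eqxx.
Qed.

Lemma proj_commute B x : measurable B -> T (E B x) = E B (T x).
Proof.
move=> mB; have mC : measurable (~` B) by exact: measurableC.
have cross u w : rip (T (E B u)) (E (~` B) w) = 0.
  pose v := E B u + E (~` B) w.
  have Bv : E B v = E B u.
    by rewrite /v raddfD /= proj_idem // (proj_disj E _ mB mC) ?setICr // addr0.
  have Cv : E (~` B) v = E (~` B) w.
    by rewrite /v raddfD /= (proj_disj E _ mC mB) ?setICl // proj_idem // add0r.
  have := quad_split v mB; rewrite Bv Cv -!quadE /v symD !ripDl !ripDr.
  rewrite (Tsym (E (~` B) w) (E B u)) (ripC (E (~` B) w)); lra.
have h u : T (E B u) = E B (T (E B u)).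
  apply/eqP; rewrite -subr_eq0 -proj_compl //; apply/eqP/rip_all0 => y.
  by rewrite proj_sym // cross.
apply/eqP; rewrite -subr_eq0; apply/eqP/rip_all0 => y.
have -> : rip (T (E B x) - E B (T x)) y =
    rip (T (E B x)) y - rip (T x) (E B y) by rewrite ripBl (proj_sym E (T x)).
rewrite (Tsym x) (h y) -(proj_sym E x) // -Tsym.
by rewrite -(proj_sym E (T (E B x))) // -h subrr.
Qed.

Lemma spectral_quad_bound S x (c d : R) : measurable S ->
  S `<=` `[c - d, c + d]%classic -> E S x = x ->
  `|rip (T x) x - c * rip x x| <= d * rip x x.
Proof.
move=> mS Scd Sx.
have mux : scalar_measure E x (~` S) = 0%E by rewrite -Sx proj_carrier.
have int := spectral_integrable x.
have mS_fin : fine (scalar_measure E x S) = rip x x.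
  by rewrite scalar_measureE // Sx.
have intS : (scalar_measure E x).-integrable S (EFin \o (fun l : RR => l : R)).
  exact: integrableS int.
have intc k : (scalar_measure E x).-integrable S (EFin \o (fun l : RR =>
  k : R)).
  apply: measurable_bounded_integrable => //.
    by apply: le_lt_trans (ltry (rip x x)); exact: scalar_measure_le.
  by exists `|k|; split; [exact: num_real|move=> s ks l _; exact: ltW].
rewrite quadE (Rintegral_carrier mS int mux) ler_distl -!mS_fin -mulrBl -mulrDl.
rewrite -!Rintegral_cst //; apply/andP; split;
  apply: le_Rintegral => // l /Scd /=;
  by rewrite in_itv /= => /andP[].
Qed.

(** On the range of [E S] the quadratic form of [F = T - c] is bounded by [d]. Polarization
    transfers the bound to the bilinear form, which is then tested on [F x]. *)
Lemma spectral_residual S x (c d : R) : 0 <= d -> measurable S ->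
  S `<=` `[c - d, c + d]%classic -> E S x = x ->
  rip (T x - c%:C *: x) (T x - c%:C *: x) <= d ^+ 2 * rip x x.
Proof.
move=> d0 mS Scd Sx.
have [F FE] : exists F, forall y, F y = T y - c%:C *: y by eexists.
have FD y z : F (y + z) = F y + F z.
  by rewrite !FE symD scalerDr opprD addrACA.
have FN y : F (- y) = - F y by rewrite !FE symN scalerN opprB opprK addrC.
have Fsym y z : rip (F y) z = rip y (F z).
  by rewrite !FE ripBl ripBr Tsym ripZl ripZr.
have FS y : E S y = y -> E S (F y) = F y.
  by move=> Sy; rewrite !FE raddfB /= -proj_commute // (linearZ_LR (E S)) /= Sy.
have Fq y : E S y = y -> `|rip (F y) y| <= d * rip y y.
  by move=> Sy; rewrite !FE ripBl ripZl; exact: spectral_quad_bound Sy.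
have key y z : E S y = y -> E S z = z ->
    2 * rip (F y) z <= d * (rip y y + rip z z).
  move=> Sy Sz.
  have := Fq (y + z); rewrite raddfD /= Sy Sz => /(_ erefl).
  have := Fq (y - z); rewrite raddfB /= Sy Sz => /(_ erefl).
  rewrite (rip_sqrD y z) (rip_sqrB y z) !FD FN !ripDl !ripDr !ripNl !ripNr
    opprK.
  rewrite (Fsym z y) (ripC z (F y)) !ler_norml => /andP[h1 _] /andP[_ h2].
  lra.
have [z0|zn0] := eqVneq (F x) 0.
  by rewrite -FE z0 rip0l mulr_ge0 ?rip_ge0 ?sqr_ge0.
have a0 : 0 < rip (F x) (F x) by rewrite lt_neqAle eq_sym rip_eq0 zn0 rip_ge0.
(* Applying [key] to [s x] and [F x] for every real [s] gives a quadratic inequality; its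
   discriminant is the claim. *)
have h : rip (F x) (F x) ^+ 2 <= (d * rip (F x) (F x)) * (d * rip x x).
  rewrite -[X in X <= _]sqrrN; apply: discriminant.
    by rewrite mulr_ge0 // rip_ge0.
  move=> s; have := key (s%:C *: x) (F x).
  rewrite linearZ /= Sx => /(_ erefl (FS _ Sx)).
  by rewrite Fsym !ripZl !ripZr -Fsym; lra.
rewrite -FE -(ler_pM2l a0) -expr2; apply: le_trans h _.
by rewrite le_eqVlt; apply/orP; left; apply/eqP; ring.
Qed.

End spectral_measure.

End spectral.

(** * Quantitative failure of mutual singularity *)

Section singularity.
Context {R : realType}.
Local Notation RR := (measurableTypeR R).
Local Open Scope ereal_scope.
Implicit Types (mu nu : {measure set RR -> \bar R}).

(** [P] is the positive set, inside [I], of a Hahn decomposition of the signed measure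
    [a mu - nu]. *)
Lemma hahn_comparison mu nu (I : set RR) (a : R) : measurable I ->
  mu I < +oo -> nu I < +oo ->
  exists P : set RR, [/\ measurable P, P `<=` I,
    forall B, measurable B -> B `<=` P -> nu B <= a%:E * mu B &
    forall B, measurable B -> B `<=` I `\` P -> a%:E * mu B <= nu B].
Proof.
move=> mI muI nuI.
pose d := cadd (cscale a (charge_of_finite_measure (mfrestr mI muI)))
  (copp (charge_of_finite_measure (mfrestr mI nuI))).
have dE B : measurable B -> B `<=` I -> d B = a%:E * mu B - nu B.
  move=> mB BI; have -> : d B = a%:E * mu (B `&` I) - nu (B `&` I) by [].
  by rewrite (setIidl BI).
have fin_nu B : measurable B -> B `<=` I -> nu B \is a fin_num.
  move=> mB BI; rewrite ge0_fin_numE //; apply: (le_lt_trans _ nuI).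
  by apply: le_measure; rewrite ?inE.
have [P [N [[mP posP] [mN negN] PN PN0]]] := Hahn_decomposition d.
exists (P `&` I); split.
- exact: measurableI.
- exact: subIsetr.
- move=> B mB BP; have BI : B `<=` I by move=> t /BP[].
  have : 0 <= d B := posP B mB (fun t Bt => (BP t Bt).1).
  by rewrite dE // sube_ge0 ?fin_nu // orbT.
- move=> B mB BP; have BI : B `<=` I by move=> t /BP[].
  have BN : B `<=` N.
    move=> t Bt; have [It nPt] := BP t Bt.
    by have : [set: RR] t by []; rewrite -PN => -[Pt|//]; case: nPt.
  have : d B <= 0 := negN B mB BN.
  by rewrite dE // sube_le0.
Qed.

Local Notation itvN M := (`[(- M%:R)%R, M%:R]%classic : set R).

Lemma itvN_cover (t : R) : exists M, itvN M t.
Proof.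
exists (Num.truncn `|t|).+1; rewrite /= in_itv /= -ler_norml.
by rewrite ltW // truncnS_gt.
Qed.

(** For [x = (M, m)], compare [nu] with [m mu] on [[-M, M]]. If some [P x] has positive [nu]
    measure, inner regularity yields [G] in it, off the Lebesgue carrier. Otherwise the union of the
    [P x] separates [mu] from [nu]. A single integer [a] bounds the interval, the mass and the
    density, so that countably many cases suffice. *)
Lemma not_singular_comparison mu nu :
  mu setT < +oo -> radon_measure nu ->
  mutually_singular nu (@lebesgue_measure R) ->
  ~ mutually_singular mu nu ->
  exists (a : nat) (G : set R), [/\ compact G, G `<=` itvN a.+1,
    @lebesgue_measure R G = 0, (a.+1%:R^-1)%:E <= nu G &
    forall B, measurable (B : set RR) -> B `<=` G -> nu B <= a.+1%:R%:E * mu B].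
Proof.
move=> mufin [nucpt nureg] [N0 [mN0 nuN0 lebN0]] nsing.
have mI M : measurable (itvN M : set RR) by exact: measurable_itv.
have cI M : compact (itvN M) by exact: segment_compact.
have nuI M : nu (itvN M) < +oo by exact: nucpt.
have muI (B : set RR) : measurable B -> mu B < +oo.
  by move=> mB; apply: le_lt_trans mufin; apply: le_measure; rewrite ?inE.
have /choice [P hP] : forall x : nat * nat, exists P : set RR,
    [/\ measurable P, P `<=` itvN x.1,
    forall B, measurable B -> B `<=` P -> nu B <= x.2%:R%:E * mu B &
    forall B, measurable B -> B `<=` itvN x.1 `\` P ->
      x.2%:R%:E * mu B <= nu B].
  by move=> x; apply: hahn_comparison => //; exact: muI.
have [[x nuPx]|all0] := pselect (exists x, 0 < nu (P x)).
  have [mP PI Ple _] := hP x.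
  have mPN : measurable (P x `&` ~` N0).
    by apply: measurableI => //; exact: measurableC.
  have : 0 < nu (P x `&` ~` N0).
    apply: lt_le_trans nuPx _; rewrite (measureDI nu mP mN0).
    rewrite [X in _ + X](_ : _ = 0) ?adde0 -?setDE //.
    by apply/eqP; rewrite eq_le measure_ge0 andbT -nuN0 le_measure ?inE //;
      exact: measurableI.
  rewrite nureg // => /ereal_sup_gt [_ [G [cG GP] <-] nuG].
  have nuGoo := nucpt G cG.
  have nuGfin : nu G \is a fin_num by rewrite ge0_fin_numE.
  have g0 : (0 < fine (nu G))%R by rewrite fine_gt0 // nuG.
  have mG : measurable (G : set RR) by exact: compact_measurable.
  pose a := maxn (maxn x.1 x.2) (Num.truncn (fine (nu G))^-1).
  have ax1 : (x.1 <= a)%N by rewrite /a !leq_max leqnn.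
  have ax2 : (x.2 <= a)%N by rewrite /a !leq_max leqnn orbT.
  have ag : (Num.truncn (fine (nu G))^-1 <= a)%N by rewrite /a !leq_max leqnn
    !orbT.
  exists a, G; split => //.
  - move=> t /GP[/PI] /=; rewrite !in_itv /= => /andP[h1 h2] _.
    have h3 : (x.1%:R <= a.+1%:R :> R)%R by rewrite ler_nat leqW.
    by rewrite (le_trans _ h1) ?(le_trans h2) // lerN2.
  - apply/eqP; rewrite eq_le measure_ge0 andbT -lebN0 le_measure ?inE //.
      exact: measurableC.
    by move=> t /GP[].
  - rewrite -(fineK nuGfin) lee_fin -[leRHS]invrK lef_pV2 ?posrE ?invr_gt0 //.
    apply: (@le_trans _ _ (Num.truncn (fine (nu G))^-1).+1%:R).
      by rewrite ltW // truncnS_gt.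
    by rewrite ler_nat ltnS.
  - move=> B mB BG; apply: le_trans (Ple B mB _) _.
      by move=> t /BG /GP[].
    by apply: lee_wpmul2r; rewrite ?lee_fin ?ler_nat // leqW.
(* All [P x] are now [nu]-null. Off their union [m mu <= nu] holds on [[-M, M]] for all [m], and
   [nu] is finite there, so [mu] vanishes. *)
exfalso; apply: nsing.
have nuP0 x : nu (P x) = 0.
  apply/eqP; rewrite eq_le measure_ge0 andbT leNgt; apply/negP => h.
  by apply: all0; exists x.
pose F n := if unpickle n is Some x then P x else set0.
have mF n : measurable (F n).
  by rewrite /F; case: unpickle => // x; have [] := hP x.
have mS : measurable (\bigcup_n F n) by exact: bigcupT_measurable.
have mSC : measurable (~` \bigcup_n F n) by exact: measurableC.
exists (~` \bigcup_n F n); split => //; last first.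
  rewrite setCK; apply/negligibleP => //; apply: negligible_bigcup => n.
  apply/negligibleP => //; rewrite /F; case: unpickle => // ; exact: measure0.
apply/negligibleP => //.
have -> : ~` (\bigcup_n F n) = \bigcup_M (~` (\bigcup_n F n) `&` itvN M).
  by rewrite -setI_bigcupr; apply/esym/setIidPl => t _;
    have [M] := itvN_cover t; exists M.
apply: negligible_bigcup => M; apply/negligibleP; first exact: measurableI.
set B := _ `&` _; have mB : measurable B by exact: measurableI.
have le_a (a : nat) : a%:R%:E * mu B <= nu (itvN M).
  have [_ _ _ h] := hP (M, a); apply: le_trans (h B mB _) _.
    move=> t [St It]; split => // Pt; apply: St.
    by exists (pickle (M, a)) => //; rewrite /F pickleK.
  by apply: le_measure; rewrite ?inE //; exact: subIsetr.
have muBfin : mu B \is a fin_num by rewrite ge0_fin_numE // muI.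
have nuIfin : nu (itvN M) \is a fin_num by rewrite ge0_fin_numE.
apply/eqP; rewrite eq_le measure_ge0 andbT leNgt; apply/negP => muB0.
have b0 : (0 < fine (mu B))%R by rewrite fine_gt0 // muB0 muI.
pose a := (Num.truncn (fine (nu (itvN M)) / fine (mu B))).+1.
have := le_a a; rewrite -(fineK muBfin) -(fineK nuIfin) -EFinM lee_fin.
by rewrite -ler_pdivlMr // leNgt truncnS_gt.
Qed.

End singularity.

(** * The subspace of vectors with singular spectral measure *)

Section singular_subspace.
Context {R : realType} {H : hilbertType R}.
Local Open Scope complex_scope.
Local Notation RR := (measurableTypeR R).
Variables (T : H -> H) (E : projection_measure H).
Hypothesis TE : is_spectral_measure_of T E.
Hypothesis Tsym : forall x y, rip (T x) y = rip x (T y).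
Variable sigma : {measure set RR -> \bar R}.
Local Notation sing := [set y | mutually_singular (scalar_measure E y) sigma].

Lemma singular_projE y : sing y <->
  exists N : set RR, [/\ measurable N, E N y = 0 & sigma (~` N) = 0%E].
Proof.
split=> -[N [mN h sN]]; exists N; split => //.
  move: h; rewrite -[LHS]/(scalar_measure E y N) scalar_measureE // proj_rip //.
  by move=> [/eqP]; rewrite rip_eq0 => /eqP.
by rewrite -[LHS]/(scalar_measure E y N) scalar_measureE // h rip0l.
Qed.

Lemma proj_eq0_subset (N N' : set RR) y : measurable N -> measurable N' ->
  N' `<=` N -> E N y = 0 -> E N' y = 0.
Proof.
move=> mN mN' NN' Ny.
by rewrite -(setIidl NN') projI // Ny raddf0.
Qed.

(** A limit of singular vectors uses the intersection of the countably many sets [N k], still of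
    full [sigma] measure; a sum uses the intersection of two. Invariance comes from
    [proj_commute]. *)
Lemma singular_closed_invariant : closed_invariant_subspace T sing.
Proof.
split.
- move=> y cy; apply/singular_projE.
  have /choice [u hu] : forall k : nat, exists z, sing z /\
      rip (y - z) (y - z) < k.+1%:R^-1.
    move=> k; have k0 : 0 < (k.+1%:R^-1 : R) by rewrite invr_gt0.
    have s0 : 0 < Num.sqrt (k.+1%:R^-1 : R) by rewrite sqrtr_gt0.
    have sC : 0 < (Num.sqrt (k.+1%:R^-1 : R))%:C :> R[i] by rewrite ltcR.
    have [z [sz]] := cy _ (nbhsx_ballx y _ sC).
    rewrite -ball_normE /= norm_ltP // sqr_sqrtr; last exact: ltW.
    by exists z.
  have /choice [N hN] : forall k, exists N : set RR,
      [/\ measurable N, E N (u k) = 0 & sigma (~` N) = 0%E].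
    by move=> k; apply/singular_projE; exact: (hu k).1.
  have mN k : measurable (N k) by have [] := hN k.
  have mI : measurable (\bigcap_k N k) by exact: bigcapT_measurable.
  exists (\bigcap_k N k); split => //.
    apply/eqP; rewrite -rip_eq0; apply/eqP/le_anti; rewrite rip_ge0 andbT.
    apply/ler_addgt0Pr => e e0; rewrite add0r.
    have [k _ hk] := near_infty_natSinv_lt (PosNum e0).
    have h : k.+1%:R^-1 < e := hk k (leqnn k).
    have uk0 : E (\bigcap_k N k) (u k) = 0.
      have [_ h0 _] := hN k; apply: proj_eq0_subset h0 => //; exact: bigcap_inf.
    rewrite -(subr0 (E _ y)) -uk0 -raddfB /= -proj_rip //.
    have := scalar_measure_le E (y - u k) mI;
      rewrite scalar_measureE // lee_fin.
    by move=> /le_trans; apply; apply: ltW; apply: lt_trans h; exact: (hu k).2.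
  rewrite setC_bigcap; apply/negligibleP.
    by apply: bigcupT_measurable => k; exact: measurableC.
  apply: negligible_bigcup => k; apply/negligibleP; first exact: measurableC.
  by have [] := hN k.
- by apply/singular_projE; exists setT; split => //;
    [rewrite raddf0|rewrite setCT measure0].
- move=> a x y /singular_projE [N [mN Nx sN]] /singular_projE [N' [mN' Ny sN']].
  apply/singular_projE; exists (N `&` N'); split; first exact: measurableI.
    rewrite (linearD (E _)) (linearZ_LR (E _)) /= (proj_eq0_subset mN _ _ Nx)
      ?scaler0 ?add0r //;
      last exact: measurableI.
    by apply: proj_eq0_subset Ny => //; exact: measurableI.
  rewrite setCI; apply/negligibleP.
    by apply: measurableU; exact: measurableC.
  by apply: negligibleU; apply/negligibleP => //; exact: measurableC.
- move=> x /singular_projE [N [mN Nx sN]]; apply/singular_projE; exists N.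
  split => //; rewrite -(proj_commute TE Tsym) // Nx.
  by apply: (addrI (T 0)); rewrite -(symD Tsym) !addr0.
Qed.

End singular_subspace.

(** * Combinations of the perturbing operators *)

Section perturbation_facts.
Context {R : realType} {H : hilbertType R} {n : nat}.
Local Open Scope complex_scope.
Variable K : 'I_n -> {linear H -> H}.
Implicit Types (t : 'rV[R]_n) (x y : H).

Lemma combinationDl t t' x :
  combination K (t + t') x = combination K t x + combination K t' x.
Proof.
rewrite /combination -big_split /=; apply: eq_bigr => k _.
by rewrite mxE rmorphD scalerDl.
Qed.

Lemma combinationZl (c : R) t x :
  combination K (c *: t) x = c%:C *: combination K t x.
Proof.
rewrite /combination scaler_sumr; apply: eq_bigr => k _.
by rewrite mxE rmorphM scalerA.
Qed.

Lemma combination0l x : combination K 0 x = 0.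
Proof. by rewrite /combination big1 // => k _; rewrite mxE scale0r. Qed.

Lemma combinationNl t x : combination K (- t) x = - combination K t x.
Proof. by rewrite -scaleN1r combinationZl rmorphN1 scaleN1r. Qed.

Lemma combination_suml (I : finType) (t : I -> 'rV[R]_n) x :
  combination K (\sum_i t i) x = \sum_i combination K (t i) x.
Proof.
apply: (big_morph (combination K ^~ x)) => [? ?|]; first exact: combinationDl.
exact: combination0l.
Qed.

Lemma combination_linear t (a : R[i]) x y :
  combination K t (a *: x + y) = a *: combination K t x + combination K t y.
Proof.
rewrite /combination scaler_sumr -big_split /=; apply: eq_bigr => k _.
by rewrite linearP scalerDr !scalerA mulrC.
Qed.

Lemma combinationDr t x y :
  combination K t (x + y) = combination K t x + combination K t y.
Proof. by rewrite -[x in LHS]scale1r combination_linear scale1r. Qed.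

Lemma combination0r t : combination K t 0 = 0.
Proof. by apply: (addrI (combination K t 0));
  rewrite -combinationDr !addr0. Qed.

Lemma combinationZr t a x : combination K t (a *: x) = a *: combination K t x.
Proof. by rewrite -[a *: x in LHS]addr0 combination_linear combination0r addr0.
  Qed.

Lemma bounded_op_continuous (f : {linear H -> H}) : bounded_op f ->
  continuous f.
Proof.
move=> [M hM]; apply: bounded_linear_continuous; apply/linear_boundedP.
exists M%:C; split; first by rewrite complex_real.
move=> r Mr x; apply: le_trans (hM x) _.
by apply: ler_wpM2r => //; exact: ltW.
Qed.

Lemma combination_continuous t : (forall k, bounded_op (K k)) ->
  continuous (combination K t).
Proof.
move=> K_bounded; rewrite /combination /index_enum;
  elim: (Finite.enum _) => [|k s IH].
  under eq_fun do rewrite big_nil; exact: cst_continuous.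
under eq_fun do rewrite big_cons; move=> x; apply: cvgD; last exact: IH.
by apply: cvgZl_tmp; exact: bounded_op_continuous.
Qed.

Hypothesis K_sa : forall k, self_adjoint (K k).

Lemma combination_sym t x y :
  rip (combination K t x) y = rip x (combination K t y).
Proof.
rewrite /combination rip_suml rip_sumr; apply: eq_bigr => k _.
by rewrite ripZl ripZr /rip K_sa.
Qed.

Lemma combination_psd t : nonneg_op (combination K t) ->
  psd_form (fun x y => rip (combination K t x) y).
Proof.
move=> t0; split => [x y z|r x y|x y|x].
- by rewrite combinationDr ripDl.
- by rewrite combinationZr ripZl.
- by rewrite combination_sym ripC.
- by have := t0 x; rewrite lecE => /andP[].
Qed.

Variable A : {linear H -> H}.
Hypothesis A_sa : self_adjoint A.

Lemma perturbation_sym t x y :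
  rip (perturbation A K t x) y = rip x (perturbation A K t y).
Proof. by rewrite /perturbation ripDl ripDr combination_sym /rip A_sa. Qed.

(** The singular vectors form a closed subspace invariant under [A_t]. By density of [S] and
    continuity it contains the range of each [K_(tau i)], hence of every [K_t'], as the [tau i]
    span. Subtracting [K_t] shows that it is also invariant under [A], and cyclicity makes it
    everything. *)
Lemma singular_everywhere (S : set H) (I : finType) (tau : I -> 'rV[R]_n) t0 t
    (P : projection_measure H)
    (sigma : {measure set (measurableTypeR R) -> \bar R}) :
  (forall k, bounded_op (K k)) -> dense S ->
  (forall t', exists c : I -> R, t' = \sum_i c i *: tau i) ->
  cyclic_set A (range (combination K t0)) ->
  is_spectral_measure_of (perturbation A K t) P ->
  (forall i w, S w ->
    mutually_singular (scalar_measure P (combination K (tau i) w)) sigma) ->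
  forall x, mutually_singular (scalar_measure P x) sigma.
Proof.
move=> K_bounded dS span cyc TP Ssing.
pose M := [set y | mutually_singular (scalar_measure P y) sigma].
have [cM M0 Mlin MT] := singular_closed_invariant TP (perturbation_sym t) sigma.
have MD y z : M y -> M z -> M (y + z).
  by move=> My Mz; rewrite -[y]scale1r; exact: Mlin.
have MZ a y : M y -> M (a *: y).
  by move=> My; rewrite -[_ *: _]addr0; exact: Mlin.
have Mtau i w : M (combination K (tau i) w).
  apply: cM => B nB.
  have := @combination_continuous (tau i) K_bounded w B nB.
  rewrite nbhsE => -[U [oU Uw] UB].
  have [z [Uz Sz]] := dS U (ex_intro _ w Uw) oU.
  by exists (combination K (tau i) z); split; [exact: Ssing|exact: UB].
have Mcomb t' w : M (combination K t' w).
  have [c ->] := span t'; rewrite combination_suml; elim/big_ind: _ => //.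
  by move=> i _; rewrite combinationZl; exact: MZ.
have MA y : M y -> M (A y).
  move=> My; have -> : A y = perturbation A K t y + (-1) *: combination K t y.
    by rewrite /perturbation scaleN1r addrK.
  by apply: MD; [exact: MT|exact: MZ].
move=> x; have : [set: H] x by [].
rewrite -cyc; apply: (@smallest_sub _ _ _ M) => //.
by move=> _ [w _ <-].
Qed.

End perturbation_facts.

(** * Grids and approximate eigenvectors *)

Section grid_intervals.
Context {R : realType}.
Local Notation RR := (measurableTypeR R).
Variable A : nat.
Implicit Types (N : nat) (G : set R).

Lemma bigsetUP (T : Type) (I : finType) (P : pred I) (F : I -> set T) t :
  (\big[setU/set0]_(i | P i) F i) t <-> exists2 i, P i & F i t.
Proof.
rewrite -bigcup_seq_cond; split=> [[i /andP[_ Pi] Fit]|[i Pi Fit]];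
  exists i => //.
by rewrite /= mem_index_enum.
Qed.

Definition grid_point N (k : nat) : R := - A%:R + k%:R / N.+1%:R.

(** One interval more than the length of [[-A, A]] requires: the intervals are half-open, and the
    last one starts at [A] to cover that end point. *)
Definition grid_itv N (k : 'I_(2 * A * N.+1).+1) : set R :=
  `[grid_point N k, grid_point N k.+1[%classic.

Lemma grid_point_lt N k l : (grid_point N k < grid_point N l) = (k < l)%N.
Proof. by rewrite /grid_point ltrD2l ltr_pM2r ?invr_gt0 // ltr_nat. Qed.

Lemma grid_pointS N k : grid_point N k.+1 = grid_point N k + N.+1%:R^-1.
Proof. by rewrite /grid_point -[k.+1%:R]natr1 mulrDl mul1r addrA. Qed.

Lemma measurable_grid_itv N k : measurable (@grid_itv N k : set RR).
Proof. exact: measurable_itv. Qed.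

Lemma trivIset_grid_itv N : trivIset setT (@grid_itv N).
Proof.
apply/trivIsetP => k l _ _; rewrite neq_ltn => /orP kl.
rewrite -subset0 => t [];
  rewrite /grid_itv /= !in_itv /= => /andP[a b] /andP[c d].
have h1 := le_lt_trans a d; have h2 := le_lt_trans c b.
rewrite !grid_point_lt !ltnS in h1 h2.
by case: kl; rewrite ltnNge ?h1 ?h2.
Qed.

Lemma grid_itv_cover N t : - A%:R <= t <= A%:R -> exists k, @grid_itv N k t.
Proof.
move=> /andP[t1 t2]; have tA : 0 <= (t + A%:R) * N.+1%:R.
  by rewrite mulr_ge0 // -lerBlDr sub0r.
pose k := Num.truncn ((t + A%:R) * N.+1%:R).
have /andP[k1 k2] := truncn_itv tA; rewrite -/k in k1 k2.
have kA : (k < (2 * A * N.+1).+1)%N.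
  rewrite ltnS -(ler_nat R); apply: le_trans k1 _.
  rewrite natrM ler_wpM2r // natrM; move: (A%:R : R) t2 => a; lra.
exists (Ordinal kA); rewrite /grid_itv /mkset in_itv /= /grid_point;
  apply/andP; split.
  by rewrite -lerBrDl opprK ler_pdivrMr.
by rewrite -ltrBlDl opprK ltr_pdivlMr.
Qed.

Lemma grid_sum (mu : {measure set RR -> \bar R}) N (G : set RR) :
  measurable G -> G `<=` `[(- A%:R)%R, A%:R]%classic ->
  (\sum_k mu (@grid_itv N k `&` G))%E = mu G.
Proof.
move=> mG GA; rewrite -(@measure_bigsetU_ord _ _ _ mu _ xpredT
  (fun k => @grid_itv N k `&` G)).
- congr (mu _); apply/seteqP; split => t; first by move=> /bigsetUP [k _ []].
  move=> Gt; have [k kt] := grid_itv_cover N (GA t Gt).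
  by apply/bigsetUP; exists k.
- by move=> k; apply: measurableI => //; exact: measurable_grid_itv.
- by apply: trivIset_setIr; exact: trivIset_grid_itv.
Qed.

(** The open neighbourhoods [F N] of radius [1 / N.+1] decrease to the closed null set [G], so their
    lengths tend to 0; [F N] contains all intervals that meet [G], whose total length is the
    left-hand side. *)
Lemma grid_null_compact G (eta : R) : compact G -> 
  G `<=` `[(- A%:R)%R, A%:R]%classic ->
  @lebesgue_measure R G = 0%E -> 0 < eta ->
  exists N0, forall N, (N0 <= N)%N ->
    #|[set k | `[< @grid_itv N k `&` G !=set0 >]]%SET|%:R / N.+1%:R <= eta.
Proof.
move=> cG GA G0 eta0.
have clG : closed G by apply: compact_closed => //; exact: Rhausdorff.
pose F (N : nat) : set RR := \bigcup_(x in G) ball x (N.+1%:R^-1 : R).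
have mF N : measurable (F N).
  by apply: open_measurable; apply: bigcup_open => x _; exact: ball_open.
have capF : \bigcap_N F N = G.
  apply/seteqP; split => t; last first.
    by move=> Gt N _; exists t => //; apply: ballxx; rewrite invr_gt0.
  move=> Ft; apply: clG => B /nbhs_ballP [e /= e0 eB].
  have [N _ hN] := near_infty_natSinv_lt (PosNum e0).
  have [x Gx xt] := Ft N I; exists x; split => //; apply: eB.
  by apply: ball_sym; apply: le_ball xt; apply: ltW; exact: (hN N (leqnn N)).
have mG : measurable (G : set RR) by exact: compact_measurable.
have F0fin : (@lebesgue_measure R (F 0%N) < +oo)%E.
  have sub : F 0%N `<=` `[(- A%:R - 1)%R, (A%:R + 1)%R]%classic.
    move=> t [x Gx]; rewrite /ball /= invr1 => xt.
    have := GA x Gx; rewrite /= !in_itv /= => /andP[x1 x2].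
    move: xt; rewrite ltr_distl => /andP[h1 h2].
    by move: (A%:R : R) x1 x2 => a x1 x2; lra.
  apply: (@le_lt_trans _ _
      (@lebesgue_measure R `[(- A%:R - 1)%R, (A%:R + 1)%R]%classic)).
    by apply: le_measure; rewrite ?inE //; exact: measurable_itv.
  by rewrite lebesgue_measure_itv /=; case: ifP => _; rewrite ?ltry.
have dF : nonincreasing_seq F.
  move=> N M NM; apply/subsetPset => t [x Gx xt]; exists x => //.
  by apply: le_ball xt; rewrite lef_pV2 ?posrE // ler_nat ltnS.
have : (@lebesgue_measure R) \o F @ \oo --> (0 : \bar R)%E.
  rewrite -[0%E]G0 -[in X in _ --> X]capF.
  by apply: nonincreasing_cvg_mu => //; rewrite capF.
move=> /fine_cvgP [_ /cvgrPdist_lt /(_ _ eta0) [N0 _ hN0]].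
exists N0 => N N0N; have := hN0 N N0N;
  rewrite /= sub0r normrN ger0_norm ?fine_ge0 // => lt.
apply: le_trans (ltW lt).
pose hit k := `[< @grid_itv N k `&` G !=set0 >].
pose V : set RR := \big[setU/set0]_(k | hit k) @grid_itv N k.
have -> : #|[set k | `[< @grid_itv N k `&` G !=set0 >]]%SET|%:R / N.+1%:R =
    fine (@lebesgue_measure R V).
  rewrite /V measure_bigsetU_ord; last exact: trivIset_grid_itv.
    rewrite (eq_bigr (fun=> (N.+1%:R^-1)%:E)) => [|k _].
      rewrite sumEFin /= sumr_const -[RHS]mulr_natl; congr (_%:R * _).
      by apply: eq_card => k; rewrite !inE.
    rewrite -[LHS]/(@lebesgue_measure R (grid_itv k)) lebesgue_measure_itv /=.
    rewrite lte_fin grid_point_lt ltnSn.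
    by rewrite -EFinB grid_pointS addrAC subrr add0r.
  by move=> k; exact: measurable_grid_itv.
have sub : V `<=` F N.
  move=> t /bigsetUP [k /asboolP [x [kx Gx]] kt]; exists x => //.
  rewrite /ball /= ltr_distl; move: kx kt; rewrite /grid_itv /= !in_itv /=.
  rewrite grid_pointS => /andP[h1 h2] /andP[h3 h4].
  by move: (grid_point N k) (N.+1%:R^-1) h1 h2 h3 h4 => a b; lra.
have mV : measurable V.
  by apply: bigsetU_measurable => k _; exact: measurable_grid_itv.
have FNfin : (@lebesgue_measure R (F N) < +oo)%E.
  apply: le_lt_trans F0fin; apply: le_measure; rewrite ?inE //.
  by apply/subsetPset; exact: dF.
have VFN : (@lebesgue_measure R V <= @lebesgue_measure R (F N))%E.
  by apply: le_measure; rewrite ?inE.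
by apply: fine_le => //; rewrite ge0_fin_numE //; exact: le_lt_trans FNfin.
Qed.

End grid_intervals.

Section approximate_eigenvectors.
Context {R : realType} {H : hilbertType R}.
Local Open Scope complex_scope.
Implicit Types (f g : H -> H -> R).

Lemma psd_sum f (I : finType) (F : {set I}) (p : I -> H) y : psd_form f ->
  f (\sum_(i in F) p i) y = \sum_(i in F) f (p i) y.
Proof.
move=> [fD _ _ _]; apply: (big_morph (f^~ y) (fun a b => fD a b y)).
by have := fD 0 0 y; rewrite addr0; lra.
Qed.

(** Let [m] be the cardinal and [z] the sum of the [p i]. Then [g z w >= m c], while
    [g z z <= f z z <= m (B + m gam)]. Cauchy-Schwarz for [g] gives [m c^2 <= W B + m W gam], and
    the last term is absorbed on the left. *)
Lemma almost_orthogonal_card f g (I : finType) (F : {set I}) (p : I -> H) w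
    (B gam c W : R) : psd_form f -> psd_form g ->
  (forall x, g x x <= f x x) ->
  (forall i, i \in F -> f (p i) (p i) <= B) ->
  (forall i j, i \in F -> j \in F -> i != j -> f (p i) (p j) <= gam) ->
  (forall i, i \in F -> c <= g (p i) w) ->
  g w w <= W -> 0 < c -> 0 <= gam -> 0 <= B -> W * gam <= c ^+ 2 / 2 ->
  #|F|%:R * c ^+ 2 <= 2 * W * B.
Proof.
move=> pf pg gf fB fgam gc gW c0 gam0 B0 Wgam.
have [fD fZ fC f0] := pf; have [_ _ _ g0] := pg.
have W0 : 0 <= W by exact: le_trans (g0 w) gW.
have [->|F0] := eqVneq F finset.set0.
  by rewrite cards0 mul0r !mulr_ge0.
have m0 : 0 < #|F|%:R :> R by rewrite ltr0n card_gt0.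
pose z := \sum_(i in F) p i.
have gz : #|F|%:R * c <= g z w.
  have -> : #|F|%:R * c = \sum_(i in F) c by rewrite sumr_const mulr_natl.
  by rewrite /z psd_sum //; apply: ler_sum.
have fz : f z z <= #|F|%:R * (B + #|F|%:R * gam).
  rewrite {1}/z psd_sum // mulr_natl -sumr_const; apply: ler_sum => i iF.
  rewrite fC psd_sum // (bigD1 i) //=; apply: lerD; first exact: fB.
  apply: (@le_trans _ _ (\sum_(j in F) gam)).
    rewrite [leRHS](bigD1 i) //= -[leLHS]add0r; apply: lerD => //.
    by apply: ler_sum => j /andP[jF ji]; exact: fgam.
  by rewrite sumr_const mulr_natl.
have CS := psd_form_CS z w pg.
have h1 : (#|F|%:R * c) ^+ 2 <= g z w ^+ 2.
  by rewrite lerXn2r ?nnegrE ?mulr_ge0 // ?(ltW c0) // (le_trans _ gz) //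
    mulr_ge0 // ltW.
have h2 : g z z * g w w <= #|F|%:R * (B + #|F|%:R * gam) * W.
  by apply: ler_pM => //; exact: le_trans (gf z) fz.
have h := le_trans h1 (le_trans CS h2).
have : #|F|%:R * (#|F|%:R * c ^+ 2) <= #|F|%:R * (B * W + #|F|%:R * (W * gam)).
  apply: le_trans (le_trans h _); rewrite le_eqVlt; apply/orP; left;
    apply/eqP; ring.
rewrite ler_pM2l // => h3.
have h4 : #|F|%:R * (W * gam) <= #|F|%:R * (c ^+ 2 / 2) by rewrite ler_pM2l.
move: (#|F|%:R : R) h3 h4 => m h3 h4; lra.
Qed.

End approximate_eigenvectors.

Section perturbation_pairs.
Context {R : realType} {H : hilbertType R} {n : nat}.
Local Open Scope complex_scope.
Variables (A : {linear H -> H}) (K : 'I_n -> {linear H -> H}).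
Hypothesis K_sa : forall k, self_adjoint (K k).
Hypothesis A_sa : self_adjoint A.
Implicit Types (t : 'rV[R]_n) (x y : H).

Lemma rip_le_sqr x y (d : R) : 0 <= d -> rip x x * rip y y <= d ^+ 2 ->
  `|rip x y| <= d.
Proof.
move=> d0 h; rewrite -(ler_pXn2r (ltn0Sn 1)) ?nnegrE // real_normK ?num_real //.
exact: le_trans (rip_CS x y) h.
Qed.

Lemma psd_le_bound f x y (B : R) : psd_form f -> f x x <= B -> f y y <= B ->
  `|f x y : R| <= B.
Proof.
move=> pf fx fy; have [_ _ _ f0] := pf.
have B0 : 0 <= B by exact: le_trans (f0 x) fx.
rewrite -(ler_pXn2r (ltn0Sn 1)) ?nnegrE // real_normK ?num_real //.
apply: le_trans (psd_form_CS (H := H) x y pf) _.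
by rewrite expr2; apply: ler_pM.
Qed.

(* Self-adjointness turns the pairing of the two residuals into the form of the
   difference of the two perturbations. *)
Lemma residual_pair t t' x y (c d : R) : 0 <= d ->
  (let r := perturbation A K t x - c%:C *: x in rip r r * rip y y <= d ^+ 2) ->
  (let r := perturbation A K t' y - c%:C *: y in rip r r * rip x x <= d ^+ 2) ->
  `|rip (combination K (t - t') x) y| <= 2 * d.
Proof.
move=> d0 /= /(rip_le_sqr d0) h1 /(rip_le_sqr d0) h2.
have -> : rip (combination K (t - t') x) y =
    rip (perturbation A K t x - c%:C *: x) y -
    rip (perturbation A K t' y - c%:C *: y) x.
  rewrite combinationDl combinationNl /perturbation !ripDl !ripNl !ripZl.
  rewrite (combination_sym K_sa t' x) (ripC x (combination K t' y)).
  have -> : rip (A x) y = rip (A y) x by rewrite ripC /rip A_sa.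
  by rewrite (ripC y x); ring.
apply: le_trans (ler_normB _ _) _; lra.
Qed.

End perturbation_pairs.

Section grid_vectors.
Context {R : realType} {H : hilbertType R} {n : nat}.
Local Open Scope complex_scope.
Local Notation RR := (measurableTypeR R).
Variables (A : {linear H -> H}) (K : 'I_n -> {linear H -> H}).
Hypothesis K_sa : forall k, self_adjoint (K k).
Hypothesis A_sa : self_adjoint A.
Variable sigma : {measure set RR -> \bar R}.
Hypothesis sigma_finite : forall G : set R, compact G -> (sigma G < +oo)%E.

(* The exceptional parameters, made quantitative. *)
Definition dominated_at (v : H) (a : nat) (t : 'rV[R]_n) :=
  exists P : projection_measure H,
    is_spectral_measure_of (perturbation A K t) P /\
    exists G : set R, [/\ compact G,
      G `<=` `[(- a.+1%:R)%R, a.+1%:R]%classic, @lebesgue_measure R G = 0%E,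
      ((a.+1%:R^-1)%:E <= sigma G)%E &
      forall B, measurable (B : set RR) -> B `<=` G ->
        (sigma B <= a.+1%:R%:E * scalar_measure P v B)%E].

(** The mass is taken in the whole interval [[-a-1, a+1]] and not in the compact set of
    [dominated_at], which varies with [t]: one weight must serve all parameters. *)
Definition grid_mass (a N : nat) (k : 'I_(2 * a.+1 * N.+1).+1) : R :=
  fine (sigma (grid_itv k `&` `[(- a.+1%:R)%R, a.+1%:R]%classic)).

(* [Theta] bounds from below the density of [sigma] in the grid intervals of [F];
   since [sigma] is singular, it can be prescribed before the mesh [1 / N.+1]
   is chosen. *)
Definition grid_family (f : H -> H -> R) (B Theta : R) (v : H) (a : nat)
    (t : 'rV[R]_n) (N : nat) (F : {set 'I_(2 * a.+1 * N.+1).+1})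
    (p : 'I_(2 * a.+1 * N.+1).+1 -> H) :=
  (2 * a.+1%:R)^-1 <= \sum_(k in F) grid_mass k /\
  forall k, k \in F -> [/\
    let r := perturbation A K t (p k) - (grid_point a.+1 N k)%:C *: p k in
      rip r r <= N.+1%:R^-1 ^+ 2 * rip (p k) (p k),
    Theta * rip (p k) (p k) <= N.+1%:R,
    f (p k) (p k) <= B &
    (Num.sqrt a.+1%:R)^-1 <= rip (p k) v].

(** Project [v] on the pieces [B k] of [G], normalize to [e k], and scale to [p k] with
    [|p k|^2 = 1 / b k]. The trace bound and the smallness of the number of pieces leave at least
    half of the mass on usable intervals. *)
Lemma grid_family_exists (f : H -> H -> R) (C Theta : R) (v : H) (a : nat)
    (t : 'rV[R]_n) :
  psd_form f -> 0 < C -> 0 < Theta ->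
  (forall (I : finType) (e : I -> H),
    (forall i j, i != j -> rip (e i) (e j) = 0) ->
    (forall i, rip (e i) (e i) <= 1) -> \sum_i f (e i) (e i) <= C) ->
  dominated_at v a t ->
  exists N0, forall N, (N0 <= N)%N ->
    exists F p, @grid_family f (4 * a.+1%:R * C) Theta v a t N F p.
Proof.
move=> pf C0 Theta0 ftr [P [TP [G [cG GA G0 sG Gdom]]]].
have Tsym := perturbation_sym K_sa A_sa t.
have [fD fZ fC f0] := pf.
have a0 : 0 < a.+1%:R :> R by [].
have mG : measurable (G : set RR) by exact: compact_measurable.
(* At most [eta N.+1] pieces are non-empty; those with [b k < Theta / N.+1] then carry total mass at
   most [1 / (4 a.+1)]. *)
have eta0 : 0 < (4 * a.+1%:R * Theta)^-1 by rewrite invr_gt0 !mulr_gt0.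
have [N0 hN0] := grid_null_compact cG GA G0 eta0.
exists N0 => N /hN0 {hN0}; set hit := [set k | _]%SET => hit_le.
pose B k : set RR := grid_itv (A := a.+1) (N := N) k `&` G.
have mB k : measurable (B k) by apply: measurableI => //;
  exact: measurable_grid_itv.
have Bdisj k l : k != l -> B k `&` B l = set0.
  move=> kl; rewrite -subset0 => x [[kx _] [lx _]].
  have /trivIsetP/(_ k l I I kl) <- := @trivIset_grid_itv R a.+1 N.
  by split.
have sfin (S : set RR) : measurable S -> S `<=` G -> sigma S \is a fin_num.
  move=> mS SG; rewrite ge0_fin_numE //; apply: le_lt_trans (sigma_finite cG).
  by apply: le_measure; rewrite ?inE.
have BG k : B k `<=` G by exact: subIsetr.
pose b k := fine (sigma (B k)).
have bE k : sigma (B k) = (b k)%:E by rewrite fineK // sfin.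
have b0 k : 0 <= b k by exact: fine_ge0.
have sumb : a.+1%:R^-1 <= \sum_k b k.
  rewrite -lee_fin -sumEFin; under eq_bigr do rewrite -bE.
  by rewrite grid_sum.
pose u k := P (B k) v.
have uu k : rip (u k) v = rip (u k) (u k) by rewrite proj_rip.
have bu k : b k <= a.+1%:R * rip (u k) (u k).
  by have := Gdom (B k) (mB k) (BG k);
    rewrite scalar_measureE // bE -uu -EFinM lee_fin.
pose e k := ((Num.sqrt (rip (u k) (u k)))^-1)%:C *: u k.
have ee k : rip (e k) (e k) <= 1.
  rewrite ripZl ripZr mulrA -expr2 exprVn sqr_sqrtr ?rip_ge0 //.
  have [->|un0] := eqVneq (rip (u k) (u k)) 0; first by rewrite mulr0.
  by rewrite mulVf.
have e_orth k l : k != l -> rip (e k) (e l) = 0.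
  move=> kl; have uo : rip (u k) (u l) = 0.
    by rewrite /u proj_sym // (proj_disj P v (mB k) (mB l)) ?rip0r //;
      exact: Bdisj.
  by rewrite ripZl ripZr uo !mulr0.
have fsum : \sum_k f (e k) (e k) <= C := ftr _ e e_orth ee.
(* Two kinds of pieces are discarded, those of low density and those where [f (e k) (e k)] is large
   compared to [b k]. Each kind costs at most [1 / (4 a.+1)] of a mass that is at least
   [1 / a.+1]. *)
pose F := [set k | (Theta / N.+1%:R <= b k) &&
  (f (e k) (e k) <= 4 * a.+1%:R * C * b k)]%SET.
pose p k := ((Num.sqrt (b k))^-1)%:C *: e k.
exists F, p; split.
  have m_ge k : b k <= grid_mass k.
    apply: fine_le; first by rewrite sfin.
      rewrite ge0_fin_numE //;
        apply: le_lt_trans (sigma_finite (@segment_compact _ (- a.+1%:R)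
          a.+1%:R)).
      by apply: le_measure; rewrite ?inE //; apply: measurableI => //;
        exact: measurable_grid_itv.
    apply: le_measure; rewrite ?inE //.
      by apply: measurableI; [exact: measurable_grid_itv|exact: measurable_itv].
    by move=> x [kx /GA].
  have split_b k : b k <= (k \in F)%:R * grid_mass k +
      ((k \in hit)%:R * (Theta / N.+1%:R) + (4 * a.+1%:R * C)^-1 * f (e k) (e
        k)).
    have h1 : 0 <= grid_mass k by exact: le_trans (m_ge k).
    have h2 : 0 <= Theta / N.+1%:R by rewrite divr_ge0 // ltW.
    have h3 : 0 <= (4 * a.+1%:R * C)^-1 * f (e k) (e k).
      by rewrite mulr_ge0 // invr_ge0 !mulr_ge0 // ltW.
    have h4 : 0 <= (k \in F)%:R * grid_mass k by rewrite mulr_ge0.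
    have h5 : 0 <= (k \in hit)%:R * (Theta / N.+1%:R) by rewrite mulr_ge0.
    have [kF|] := boolP (k \in F).
      apply: le_trans (m_ge k) _; rewrite mul1r lerDl addr_ge0 //.
    rewrite inE negb_and -!ltNge mul0r add0r => /orP[bk|bk]; last first.
      apply: ler_wpDl => //; rewrite mulrC ler_pdivlMr ?mulr_gt0 //.
      by rewrite mulrC ltW.
    apply: ler_wpDr => //; have [kh|] := boolP (k \in hit).
      by rewrite mul1r ltW.
    rewrite inE => /asboolPn nh; rewrite mul0r.
    have B0 : B k = set0.
      by rewrite -subset0 => x Bx; apply: nh; exists x.
    by rewrite /b B0 measure0.
  have := le_trans sumb (ler_sum _ (fun k _ => split_b k)).
  rewrite !big_split /= -mulr_suml -mulr_sumr.
  have -> : \sum_k (k \in F)%:R * grid_mass k = \sum_(k in F) grid_mass k.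
    rewrite [RHS]big_mkcond; apply: eq_bigr => k _.
    by case: ifP; rewrite ?mul1r ?mul0r.
  have -> : \sum_k (k \in hit)%:R = #|hit|%:R :> R.
    rewrite -sum1_card natr_sum [RHS]big_mkcond; apply: eq_bigr => k _.
    by case: (k \in hit).
  have h1 : #|hit|%:R * (Theta / N.+1%:R) <= (4 * a.+1%:R)^-1.
    rewrite mulrCA; apply: le_trans (ler_wpM2l (ltW Theta0) hit_le) _.
    by rewrite invfM mulrCA mulfV ?mulr1 // gt_eqF.
  have h2 : (4 * a.+1%:R * C)^-1 * \sum_k f (e k) (e k) <= (4 * a.+1%:R)^-1.
    have i0 : 0 <= (4 * a.+1%:R * C)^-1 by rewrite invr_ge0 !mulr_ge0 // ltW.
    apply: le_trans (ler_wpM2l i0 fsum) _.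
    by rewrite invfM -mulrA mulVf ?mulr1 // gt_eqF.
  have -> : (2 * a.+1%:R)^-1 = a.+1%:R^-1 - ((4 * a.+1%:R)^-1 + (4 *
    a.+1%:R)^-1) :> R.
    by field; rewrite gt_eqF.
  rewrite lerBlDr => h; apply: le_trans h _; rewrite lerD2l; exact: lerD.
move=> k; rewrite inE => /andP[bk fk].
have bk0 : 0 < b k by apply: lt_le_trans bk; rewrite divr_gt0.
have uk0 : 0 < rip (u k) (u k).
  by have := lt_le_trans bk0 (bu k); rewrite pmulr_rgt0.
have ekk : rip (e k) (e k) = 1.
  by rewrite ripZl ripZr mulrA -expr2 exprVn sqr_sqrtr ?rip_ge0 // mulVf //
    gt_eqF.
have ppk : rip (p k) (p k) = (b k)^-1.
  by rewrite ripZl ripZr mulrA -expr2 exprVn sqr_sqrtr // ekk mulr1.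
split.
- apply: (spectral_residual TP Tsym _ (mB k)); rewrite ?invr_ge0 //.
    move=> x [] /=; rewrite /grid_itv /= !in_itv /= grid_pointS =>
      /andP[h1 h2] _.
    have N1 : 0 < N.+1%:R^-1 :> R by rewrite invr_gt0.
    by move: (grid_point _ _ _) (N.+1%:R^-1 : R) h1 h2 N1 => x0 d; lra.
  by rewrite /p /e !(linearZ_LR (P (B k))) /= /u proj_idem.
- by rewrite ppk ler_pdivrMr // mulrC -ler_pdivrMr.
- rewrite /p fZ fC fZ mulrA -expr2 exprVn sqr_sqrtr // mulrC ler_pdivrMr //.
(* Here [<p k, v> = |u k| / sqrt (b k)], and the domination reads [b k <= a.+1 |u k|^2]. *)
- rewrite /p /e !ripZl uu.
  set s := rip (u k) (u k); have s0 : 0 < Num.sqrt s by rewrite sqrtr_gt0.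
  have b0' : 0 < Num.sqrt (b k) by rewrite sqrtr_gt0.
  have sE : (Num.sqrt s)^-1 * s = Num.sqrt s.
    by rewrite -[X in _ * X](sqr_sqrtr (rip_ge0 (u k))) expr2 mulKf // gt_eqF.
  rewrite sE mulrC ler_pdivlMr // mulrC ler_pdivrMr ?sqrtr_gt0 //.
  by rewrite -sqrtrM ?rip_ge0 // ler_sqrt ?mulr_ge0 ?rip_ge0 // mulrC.
Qed.

End grid_vectors.

(** * Counting cells *)

Section cell_counting.
Context {R : realType} {H : hilbertType R} {n : nat}.
Local Open Scope complex_scope.

(** Cells of side [1 / L]; the shift by [M] makes the indices natural numbers when the coordinates
    lie in [[-M, M]]. *)
Definition in_cell (L M J : nat) (q : 'rV[R]_n.+1)
    (i : {ffun 'I_n.+1 -> 'I_J}) :=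
  forall j, (i j)%:R <= L%:R * (q 0 j + M%:R) < (i j)%:R + 1.

Lemma card_le_fibers (I T : finType) (Q : {set I}) (phi : I -> T) (c : R) :
  0 <= c ->
  (forall y, #|[set i in Q | phi i == y]%SET|%:R <= c) ->
    #|Q|%:R <= #|T|%:R * c.
Proof.
move=> c0 h; have -> : #|Q| = (\sum_y #|[set i in Q | phi i == y]%SET|)%N.
  rewrite -sum1_card (partition_big phi xpredT) //=; apply: eq_bigr => y _.
  by rewrite -sum1_card; apply: eq_bigl => i; rewrite inE.
rewrite natr_sum; apply: le_trans (ler_sum _ (fun y _ => h y)) _.
by rewrite sumr_const mulr_natl.
Qed.

Lemma modn_eq_dist (a b k : nat) : a != b -> a = b %[mod k] ->
  (a + k <= b)%N || (b + k <= a)%N.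
Proof.
wlog ab : a b / (a <= b)%N => [h|].
  case/orP: (leq_total a b) => ab ne e; first exact: h.
  by rewrite orbC; apply: h => //; rewrite eq_sym.
move=> ne /eqP; rewrite eq_sym eqn_mod_dvd // => /dvdn_leq.
rewrite subn_gt0 ltn_neqAle ne ab => /(_ isT) h; apply/orP; left.
by rewrite -(subnKC ab) leq_add2l.
Qed.

(** Within a fiber of [phi] the bound on [K_(t - t')] is dominated by its [ord0] term, so the
    vectors [p i] are nearly orthogonal for [g ord0] and [almost_orthogonal_card] bounds the fiber.
    There are [J^n k.+1] fibers. *)
Lemma cells_near_eigenvalue (g : 'I_n.+1 -> H -> H -> R) (L M J k : nat)
    (Q : {set {ffun 'I_n.+1 -> 'I_J}}) (q : {ffun 'I_n.+1 -> 'I_J} ->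
      'rV[R]_n.+1)
    (p : {ffun 'I_n.+1 -> 'I_J} -> H) (j0 : 'I_n.+1) (w : H) (B c : R) :
  (0 < L)%N -> (0 < k)%N -> 0 <= B -> 0 < c ->
  (forall j, psd_form (g j)) -> (forall j x, g j x x <= g ord0 x x) ->
  (forall i, i \in Q -> in_cell L M (q i) i) ->
  (forall i, i \in Q -> g ord0 (p i) (p i) <= B) ->
  (forall i, i \in Q -> c <= g j0 (p i) w) ->
  (forall i l, i \in Q -> l \in Q ->
    `|\sum_j (q i - q l) 0 j * g j (p i) (p l)| <= 2 / L%:R) ->
  g j0 w w * ((2 + n%:R * B) / k%:R) <= c ^+ 2 / 2 ->
  #|Q|%:R * c ^+ 2 <= (J ^ n * k.+1)%:R * (2 * g j0 w w * B).
Proof.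
move=> L0 k0 B0 c0 pg gle Qcell Qf Qc Qpair small.
have [_ _ _ w0] := pg j0.
have L0' : 0 < L%:R :> R by rewrite ltr0n.
have k0' : 0 < k%:R :> R by rewrite ltr0n.
have c20 : 0 < c ^+ 2 by rewrite exprn_gt0.
(* Two cells of one fiber of [phi] lie, up to one mesh, on a common line in the
   direction of [ord0], at distance at least [k / L]. *)
pose phi (i : {ffun 'I_n.+1 -> 'I_J}) : {ffun 'I_n -> 'I_J} * 'I_k.+1 :=
  ([ffun j => i (lift ord0 j)], inord (i ord0 %% k.+1)).
rewrite -ler_pdivlMr // -[X in _ <= X]mulrA.
have -> : (J ^ n * k.+1)%N = #|{: {ffun 'I_n -> 'I_J} * 'I_k.+1}|.
  by rewrite card_prod card_ffun !card_ord.
apply: (@card_le_fibers _ _ Q phi); first by rewrite divr_ge0 ?mulr_ge0 // ltW.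
move=> y; rewrite ler_pdivlMr //.
apply: (@almost_orthogonal_card _ _ (g ord0) (g j0) _ _ p w B
  ((2 + n%:R * B) / k%:R)) => //.
- by move=> i; rewrite inE => /andP[/Qf].
- move=> i l; rewrite !inE => /andP[iQ /eqP iy] /andP[lQ /eqP ly] il.
  have [rest modk] : (forall j, i (lift ord0 j) = l (lift ord0 j)) /\
      i ord0 = l ord0 %[mod k.+1].
    move: iy; rewrite -ly => -[/ffunP h1 h2]; split.
      by move=> j; have := h1 j; rewrite !ffunE.
    have := congr1 val h2; rewrite /= !inordK ?ltn_mod //.
  have il0 : (i ord0 : nat) != l ord0.
    apply: contra il => /eqP h; apply/eqP/ffunP => j.
    by case: (unliftP ord0 j) => [j' ->|->]; [exact: rest|exact: val_inj].
  have Ci := Qcell i iQ; have Cl := Qcell l lQ.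
  (* The indices differ by at least [k.+1]; rounding coordinates to cells costs one unit. *)
  have far : k%:R / L%:R <= `|(q i - q l) 0 ord0|.
    rewrite ler_pdivrMr // mulrC -(gtr0_norm L0') -normrM.
    have /andP[a1 a2] := Ci ord0; have /andP[b1 b2] := Cl ord0.
    have E : L%:R * (q i - q l) 0 ord0 =
      L%:R * (q i 0 ord0 + M%:R) - L%:R * (q l 0 ord0 + M%:R).
      by rewrite !mxE; ring.
    rewrite E; case/orP: (modn_eq_dist il0 modk) => h.
      have : (i ord0)%:R + k.+1%:R <= (l ord0)%:R :> R by rewrite -natrD
        ler_nat.
      rewrite -natr1 distrC; move: a1 a2 b1 b2.
      move: (_ * _) (_ * _) (k%:R : R) ((i ord0)%:R : R) ((l ord0)%:R :
        R) => x y0 z u v *.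
      apply: le_trans (ler_norm _); lra.
    have : (l ord0)%:R + k.+1%:R <= (i ord0)%:R :> R by rewrite -natrD ler_nat.
    rewrite -natr1; move: a1 a2 b1 b2.
    move: (_ * _) (_ * _) (k%:R : R) ((i ord0)%:R : R) ((l ord0)%:R : R) =>
      x y0 z u v *.
    apply: le_trans (ler_norm _); lra.
  have near j : `|(q i - q l) 0 (lift ord0 j)| <= L%:R^-1.
    rewrite -[X in _ <= X]mul1r ler_pdivlMr // mulrC -(gtr0_norm L0') -normrM.
    have /andP[a1 a2] := Ci (lift ord0 j);
      have /andP[b1 b2] := Cl (lift ord0 j).
    have E : L%:R * (q i - q l) 0 (lift ord0 j) =
      L%:R * (q i 0 (lift ord0 j) + M%:R) - L%:R * (q l 0 (lift ord0 j) + M%:R).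
      by rewrite !mxE; ring.
    rewrite E; rewrite rest in a1 a2; move: a1 a2 b1 b2.
    move: (_ * _) (_ * _) ((l _)%:R : R) => x y0 u *; rewrite ler_norml; lra.
  have pair := Qpair i l iQ lQ; rewrite big_ord_recl in pair.
  have rest_le : `|\sum_(j < n) (q i - q l) 0 (lift ord0 j) * g (lift ord0 j)
    (p i) (p l)|
      <= n%:R * (L%:R^-1 * B).
    apply: le_trans (ler_norm_sum _ _ _) _.
    have -> : n%:R * (L%:R^-1 * B) = \sum_(j < n) (L%:R^-1 * B).
      by rewrite sumr_const card_ord mulr_natl.
    apply: ler_sum => j _; rewrite normrM; apply: ler_pM => //.
    by apply: psd_le_bound => //; apply: le_trans (gle _ _) (Qf _ _).
  (* The other [n] directions contribute at most [B / L] each, because their coordinates differ by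
     at most one mesh and their forms are dominated by [g ord0]. *)
  have main : `|(q i - q l) 0 ord0| * `|g ord0 (p i) (p l)| <=
      (2 + n%:R * B) / L%:R.
    rewrite -normrM; set X := _ * _ in pair *;
      set Y := \sum_(_ < _) _ in pair rest_le.
    have -> : X = (X + Y) - Y by rewrite addrK.
    apply: le_trans (ler_normB _ _) _; apply: le_trans (lerD pair rest_le) _.
    by rewrite le_eqVlt; apply/orP; left; apply/eqP; ring.
  apply: le_trans (ler_norm _) _; rewrite ler_pdivlMr // mulrC.
  rewrite -(ler_pM2r (x := L%:R^-1)) ?invr_gt0 // mulrAC.
  by apply: le_trans main; apply: ler_wpM2r.
- by move=> i; rewrite inE => /andP[/Qc].
- by rewrite divr_ge0 // addr_ge0 // mulr_ge0.
Qed.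

End cell_counting.

Section exceptional_cells.
Context {R : realType} {H : hilbertType R} {n : nat}.
Local Open Scope complex_scope.
Local Notation RR := (measurableTypeR R).
Variables (A : {linear H -> H}) (K : 'I_n.+1 -> {linear H -> H}).
Hypothesis K_sa : forall k, self_adjoint (K k).
Hypothesis A_sa : self_adjoint A.
Variable sigma : {measure set RR -> \bar R}.
Hypothesis sigma_finite : forall G : set R, compact G -> (sigma G < +oo)%E.
Variables (tau : 'I_n.+1 -> 'rV[R]_n.+1) (q : 'rV[R]_n.+1 -> 'rV[R]_n.+1).
Hypothesis q_tau : forall t t', t - t' = \sum_j (q t - q t') 0 j *: tau j.
Local Notation form j := (fun x y => rip (combination K (tau j) x) y).
Hypothesis tau_ge0 : forall j, nonneg_op (combination K (tau j)).
Hypothesis tau_le : forall j x, form j x x <= form ord0 x x.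
Variable C : R.
Hypothesis C_gt0 : 0 < C.
Hypothesis trace_le : forall (I : finType) (e : I -> H),
  (forall i j, i != j -> rip (e i) (e j) = 0) ->
  (forall i, rip (e i) (e i) <= 1) -> \sum_i form ord0 (e i) (e i) <= C.

(** For a residual at spectral mesh [d^-1] and vectors with squared norm at most [d / L], the mesh
    cancels and only the prescribed density [L] remains. *)
Lemma residual_small (r x y d L : R) : 0 < d -> 0 < L -> 0 <= r -> 0 <= y ->
  r <= d^-1 ^+ 2 * x -> L * x <= d -> L * y <= d -> r * y <= L^-1 ^+ 2.
Proof.
move=> d0 L0 r0 y0 rx xd yd.
have -> : L^-1 ^+ 2 = (d^-1 ^+ 2 * (d / L)) * (d / L).
  by field; rewrite !gt_eqF.
apply: ler_pM => //; last by rewrite ler_pdivlMr // mulrC.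
apply: le_trans rx _; apply: ler_wpM2l; first exact: sqr_ge0.
by rewrite ler_pdivlMr // mulrC.
Qed.

(** Double counting with weights [mass]: every cell of [Hit] owns intervals of total mass at least
    [1 / (2 a.+1)], and every interval is owned by at most [Y (2 M L)^n] cells. *)
Lemma exceptional_cells (j0 : 'I_n.+1) (w : H) (a M : nat) :
  exists2 X : R, 0 <= X & forall L, (0 < L)%N ->
    #|[set i : {ffun 'I_n.+1 -> 'I_(2 * M * L)} | `[< exists2 t,
      dominated_at A K sigma (combination K (tau j0) w) a t &
      in_cell L M (q t) i >] ]%SET|%:R <= X * (L ^ n)%:R.
Proof.
have psd j := combination_psd K_sa (tau_ge0 j).
have a0 : 0 < a.+1%:R :> R by [].
pose J := `[(- a.+1%:R)%R, a.+1%:R]%classic : set R.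
have cJ : compact J by exact: segment_compact.
have mJ : measurable (J : set RR) by exact: measurable_itv.
have sJ : (sigma J < +oo)%E by exact: sigma_finite.
pose S := fine (sigma J); pose B := 4 * a.+1%:R * C.
pose W := form j0 w w.
have B0 : 0 <= B by rewrite !mulr_ge0 // ltW.
have W0 : 0 <= W by have [_ _ _] := psd j0; apply.
have S0 : 0 <= S by exact: fine_ge0.
(* The separation [k] is fixed by the smallness condition of [cells_near_eigenvalue] with
   [c = 1 / sqrt a.+1]; it does not depend on [L]. *)
pose k := (Num.truncn (2 * a.+1%:R * W * (2 + n%:R * B))).+1.
have ksmall : W * ((2 + n%:R * B) / k%:R) <= (Num.sqrt a.+1%:R)^-1 ^+ 2 / 2.
  have h := ltW (truncnS_gt (2 * a.+1%:R * W * (2 + n%:R * B)));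
    rewrite -/k in h.
  rewrite exprVn sqr_sqrtr ?ler0n // [leLHS]mulrA ler_pdivrMr //.
  have -> : W * (2 + n%:R * B) = (2 * a.+1%:R)^-1 * (2 * a.+1%:R * W * (2 +
    n%:R * B)).
    by field; rewrite gt_eqF.
  by rewrite -invfM mulrC [in leRHS]mulrC [_ * 2]mulrC ler_wpM2r // invr_ge0
    mulr_ge0.
pose Y := k.+1%:R * (2 * W * B) * a.+1%:R.
have Y0 : 0 <= Y by rewrite /Y !mulr_ge0 ?ler0n ?(ltW C_gt0).
exists (2 * a.+1%:R * S * Y * (2 * M)%:R ^+ n);
  first by rewrite !mulr_ge0 ?exprn_ge0 ?ler0n ?(ltW C_gt0).
move=> L L0; set Hit := [set i | _]%SET.
have L0' : 0 < L%:R :> R by rewrite ltr0n.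
have /choice [t ht] : forall i : {ffun 'I_n.+1 -> 'I_(2 * M * L)},
    exists t, i \in Hit -> dominated_at A K sigma (combination K (tau j0) w) a
      t /\
      in_cell L M (q t) i.
  move=> i; have [|nH] := boolP (i \in Hit); last by exists 0.
  by rewrite inE => /asboolP [t h1 h2]; exists t.
(* The density bound [Theta] is taken to be [L], matching the mesh [1 / L] in parameter space. *)
pose family i N (F : {set 'I_(2 * a.+1 * N.+1).+1}) p :=
  grid_family A K sigma (form ord0) B L%:R (combination K (tau j0) w) (t i) F p.
have /choice [N0 hN0] : forall i, exists N0, i \in Hit ->
    forall N, (N0 <= N)%N -> exists F p, @family i N F p.
  move=> i; have [iH|nH] := boolP (i \in Hit); last by exists 0%N.
  have [dom _] := ht i iH.
  have [N0 hN0] := grid_family_exists K_sa A_sa sigma_finite (psd ord0) C_gt0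
    L0' trace_le dom.
  by exists N0.
(* One spectral grid for all cells, so that two parameters can be compared at the same interval. *)
pose N := \max_i N0 i.
have /choice [F hF] : forall i, exists F, i \in Hit ->
    exists p, @family i N F p.
  move=> i; have [iH|nH] := boolP (i \in Hit); last by exists finset.set0.
  have [|F [p h]] := hN0 i iH N; first exact: leq_bigmax.
  by exists F => _; exists p.
have /choice [p hp] : forall i, exists p, i \in Hit -> @family i N (F i) p.
  move=> i; have [iH|nH] := boolP (i \in Hit); last by exists (fun=> 0).
  by have [p h] := hF i iH; exists p.
pose mass l := grid_mass sigma (a := a) (N := N) l.
have mass0 l : 0 <= mass l by exact: fine_ge0.
pose Q l := [set i in Hit | l \in F i]%SET.
have memQ i l : (i \in Q l) = (i \in Hit) && (l \in F i) by rewrite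
  finset.in_set.
have Qle l : #|Q l|%:R <= Y * ((2 * M * L) ^ n)%:R.
  have c0 : 0 < (Num.sqrt a.+1%:R)^-1 :> R by rewrite invr_gt0 sqrtr_gt0.
  have := @cells_near_eigenvalue R H n (fun j x y => form j x y) L M _ k (Q l)
    (fun i => q (t i)) (fun i => p i l) j0 w B _ L0 (ltn0Sn _) B0 c0 psd tau_le.
  move=> /(_ _ _ _ _ ksmall) h.
  have {h} : #|Q l|%:R * (Num.sqrt a.+1%:R)^-1 ^+ 2 <=
      ((2 * M * L) ^ n * k.+1)%:R * (2 * W * B) :> R.
    apply: h.
    - by move=> i; rewrite memQ => /andP[iH _]; have [] := ht i iH.
    - move=> i; rewrite memQ => /andP[iH li]; have [_ h] := hp i iH.
      by have [] := h l li.
    - move=> i; rewrite memQ => /andP[iH li]; have [_ h] := hp i iH.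
      have [_ _ _] := h l li.
      by rewrite -(combination_sym K_sa).
    - move=> i i'; rewrite !memQ => /andP[iH li] /andP[i'H li'].
      have [_ /(_ l li) [r1 s1 _ _]] := hp i iH.
      have [_ /(_ l li') [r2 s2 _ _]] := hp i' i'H.
      have -> : \sum_j (q (t i) - q (t i')) 0 j * form j (p i l) (p i' l) =
          rip (combination K (t i - t i') (p i l)) (p i' l).
        rewrite (q_tau (t i) (t i')) combination_suml rip_suml;
          apply: eq_bigr => j _.
        by rewrite combinationZl ripZl.
      apply: (residual_pair K_sa A_sa (c := grid_point a.+1 N l)).
      + by rewrite invr_ge0 ltW.
      + by apply: residual_small r1 s1 s2; rewrite ?rip_ge0.
      + by apply: residual_small r2 s2 s1; rewrite ?rip_ge0.
  rewrite exprVn sqr_sqrtr ?ler0n // -/W ler_pdivrMr // => h.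
  apply: le_trans h _; rewrite natrM /Y le_eqVlt; apply/orP; left; apply/eqP;
    ring.
have mass_sum : \sum_l mass l = S.
  rewrite /S -(grid_sum sigma (A := a.+1) N mJ (fun x h => h)) -sum_fine //.
  move=> l _; rewrite ge0_fin_numE //; apply: le_lt_trans sJ.
  apply: le_measure; rewrite ?inE //.
  by apply: measurableI => //; exact: measurable_grid_itv.
have lower : #|Hit|%:R * (2 * a.+1%:R)^-1 <= \sum_(i in Hit) \sum_(l in F i)
  mass l.
  have -> : #|Hit|%:R * (2 * a.+1%:R)^-1 = \sum_(i in Hit) (2 * a.+1%:R)^-1 :>
    R.
    by rewrite sumr_const mulr_natl.
  by apply: ler_sum => i iH; have [] := hp i iH.
have upper : \sum_(i in Hit) \sum_(l in F i) mass l <= S * (Y * ((2 * M * L) ^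
  n)%:R).
  have -> : \sum_(i in Hit) \sum_(l in F i) mass l = \sum_l mass l * #|Q l|%:R.
    under eq_bigr do rewrite big_mkcond.
    rewrite exchange_big /=; apply: eq_bigr => l _.
    rewrite -big_mkcondr /= -sum1_card natr_sum mulr_sumr.
    by apply: eq_big => [i|i _]; rewrite ?memQ // mulr1.
  rewrite -mass_sum mulr_suml; apply: ler_sum => l _.
  by apply: ler_wpM2l.
have := le_trans lower upper; rewrite ler_pdivrMr ?mulr_gt0 // => h.
apply: le_trans h _; rewrite expnMn natrM natrX.
by rewrite le_eqVlt; apply/orP; left; apply/eqP; ring.
Qed.

End exceptional_cells.

(** * Hausdorff measure *)

Section hausdorff_null.
Context {R : realType} {n : nat}.
Implicit Types (X : set 'rV[R]_n) (U : (set 'rV[R]_n)^nat) (s : R).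
Local Open Scope ereal_scope.

Lemma nneseries_ub (u : (\bar R)^nat) (c : \bar R) :
  (forall i, 0 <= u i) -> (forall N, \sum_(0 <= i < N) u i <= c) ->
  \sum_(0 <= i <oo) u i <= c.
Proof.
move=> u0 h; apply: lime_le; last exact: nearW.
by apply: is_cvg_nneseries => i _ _.
Qed.

Lemma euclidean_norm_ge0 (x : 'rV[R]_n) : (0 <= euclidean_norm x)%R.
Proof. exact: sqrtr_ge0. Qed.

Lemma diameter_pow_ge0 s (U : set 'rV[R]_n) : 0 <= diameter_pow s U.
Proof. by rewrite /diameter_pow; case: ifP => // _; exact: poweR_ge0. Qed.

Lemma diameter_pow_le s (d : R) (U : set 'rV[R]_n) : (0 <= s)%R ->
  diameter U <= d%:E -> diameter_pow s U <= (d `^ s)%:E.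
Proof.
move=> s0 Ud; rewrite /diameter_pow; case: eqVneq => [_|/set0P [x Ux]].
  by rewrite lee_fin powR_ge0.
have dU : 0 <= diameter U.
  apply: (@le_trans _ _ (euclidean_norm (x - x))%:E).
    by rewrite lee_fin euclidean_norm_ge0.
  by apply: ereal_sup_ubound; exists x => //; exists x.
rewrite -poweR_EFin; apply: gt0_ler_poweR => //.
- by rewrite in_itv /= dU leey.
- by rewrite in_itv /= (le_trans dU Ud) leey.
Qed.

(** Null sets in terms of covers at every scale, a form that passes directly to countable unions. *)
Definition hausdorff_null s X := forall eta d : R, (0 < eta)%R -> (0 < d)%R ->
  exists U, [/\ X `<=` \bigcup_i U i, forall i, diameter (U i) <= d%:E &
    \sum_(0 <= i <oo) diameter_pow s (U i) <= eta%:E].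

Lemma hausdorff_null_measure s X : hausdorff_null s X ->
  hausdorff_measure s X = 0.
Proof.
move=> h; apply/eqP; rewrite eq_le; apply/andP; split.
  apply: ge_ereal_sup => _ [d /= d0 <-]; apply/lee_addgt0Pr => e e0.
  have [U [XU Ud Us]] := h e d e0 d0; rewrite add0e.
  by apply: ge_ereal_inf;
    exists (\sum_(0 <= i <oo) diameter_pow s (U i)) => //; exists U.
apply: (@le_trans _ _ (hausdorff_content s 1 X)).
  apply: le_ereal_inf_tmp => _ [U _ <-]; apply: nneseries_ge0 => i _ _.
  exact: diameter_pow_ge0.
by apply: ereal_sup_ubound; exists 1%R => //=.
Qed.

(** The covers of [X i] of total at most [eta / 2^(i+1)] are merged into one sequence by a bijection
    between [nat] and [nat * nat]. *)
Lemma hausdorff_null_bigcup s (X : nat -> set 'rV[R]_n) :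
  (forall i, hausdorff_null s (X i)) -> hausdorff_null s (\bigcup_i X i).
Proof.
move=> Xnull eta d eta0 d0.
have /choice [U hU] : forall i, exists U, [/\ X i `<=` \bigcup_j U j,
    forall j, diameter (U j) <= d%:E &
    \sum_(0 <= j <oo) diameter_pow s (U j) <= (eta / (2 ^ i.+1)%:R)%:E].
  by move=> i; apply: Xnull => //; rewrite divr_gt0 // ltr0n expn_gt0.
have /card_esym/pcard_eqP/unsquash e := card_nat2.
exists (fun k => U (e k).1 (e k).2); split.
- move=> x [i _ Xx]; have [Xi _ _] := hU i; have [j _ Ux] := Xi x Xx.
  have [k _ kij] : (e @` setT) (i, j) by rewrite image_eq.
  by exists k => //; rewrite kij.
- by move=> k; have [_ h _] := hU (e k).1.
rewrite nneseries_esumT; last by move=> k; exact: diameter_pow_ge0.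
rewrite -(@reindex_esum R _ _ setT setT e
  (fun x => diameter_pow s (U x.1 x.2))); last exact: bij.
have -> : [set: nat * nat] = [set: nat] `*`` (fun=> [set: nat]).
  by apply/seteqP; split.
rewrite -(@esum_esum R _ _ setT (fun=> setT) (fun i j =>
  diameter_pow s (U i j))); last first.
  by move=> *; exact: diameter_pow_ge0.
apply: le_trans (epsilon_trick0 xpredT (ltW eta0)).
rewrite nneseries_esumT; last first.
  by move=> i; rewrite lee_fin divr_ge0 // ltW.
apply: le_esum => i _; have [_ _ h] := hU i; apply: le_trans h.
by rewrite nneseries_esumT // => j; exact: diameter_pow_ge0.
Qed.

Lemma hausdorff_null_subset s X Y : X `<=` Y -> hausdorff_null s Y ->
  hausdorff_null s X.
Proof.
move=> XY Ynull eta d eta0 d0; have [U [YU Ud Us]] := Ynull eta d eta0 d0.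
by exists U; split => // x /XY/YU.
Qed.

(* [L] is the inverse mesh of the grid [I L], and [Q L] are its cells in use. *)
Lemma hausdorff_null_finite_covers s X (I : nat -> finType)
    (Q : forall L, {set I L}) (U : forall L, I L ->
      set 'rV[R]_n) (C D : R) (m : nat) :
  (m%:R < s)%R -> (0 <= C)%R -> (0 < D)%R ->
  (forall L, (0 < L)%N -> X `<=` \bigcup_(i in [set i | i \in Q L]) U L i) ->
  (forall L, (0 < L)%N -> forall i, i \in Q L ->
    diameter (U L i) <= (D / L%:R)%:E) ->
  (forall L, (0 < L)%N -> #|Q L|%:R <= C * (L ^ m)%:R)%R ->
  hausdorff_null s X.
Proof.
move=> ms C0 D0 XU Ud cardQ eta d eta0 d0.
have s0 : (0 < s)%R by apply: le_lt_trans ms.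
have [L [L0 Ld Leta]] : exists L, [/\ (0 < L)%N, (D / L%:R <= d)%R &
    (C * (L ^ m)%:R * (D / L%:R) `^ s <= eta)%R].
  (* The total is at most [C L^m (D / L)^s = C D^s / L^r], which is at most [eta] once
     [L >= b^(1/r)]. *)
  pose r := (s - m%:R)%R; have r0 : (0 < r)%R by rewrite subr_gt0.
  pose b := (C * D `^ s / eta)%R.
  have b0 : (0 <= b)%R by rewrite !mulr_ge0 ?powR_ge0 // invr_ge0 ltW.
  pose L := (maxn (Num.truncn (D / d)%R) (Num.truncn (b `^ r^-1)%R)).+1.
  have L0 : (0 < L%:R :> R)%R by [].
  have L1 : (D / d <= L%:R)%R.
    by rewrite ltW // (lt_le_trans (truncnS_gt _)) // ler_nat ltnS leq_maxl.
  have L2 : (b `^ r^-1 <= L%:R)%R.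
    by rewrite ltW // (lt_le_trans (truncnS_gt _)) // ler_nat ltnS leq_maxr.
  exists L; split => //.
    by rewrite ler_pdivrMr // mulrC -ler_pdivrMr.
  have L3 : (b <= L%:R `^ r)%R.
    have -> : b = ((b `^ r^-1) `^ r)%R by rewrite -powRrM mulVf ?gt_eqF //
      powRr1.
    by apply: ge0_ler_powR => //; rewrite ?nnegrE ?powR_ge0 // ltW.
  have Ls : (L%:R `^ s = (L ^ m)%:R * L%:R `^ r)%R.
    rewrite natrX -powR_mulrn // -powRD; last by rewrite pnatr_eq0 implybT.
    by congr (_ `^ _)%R; rewrite /r addrC subrK.
  have E : (C * (L ^ m)%:R * (D / L%:R) `^ s = C * D `^ s / L%:R `^ r)%R.
    have Lr0 : (0 < L%:R `^ r)%R by rewrite powR_gt0.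
    have Lm0 : (0 < (L ^ m)%:R :> R)%R by rewrite ltr0n expn_gt0.
    rewrite powRM ?invr_ge0 ?ltW // -powR_inv1 ?ltW // -powRrM mulN1r powRN Ls.
    by field; rewrite !gt_eqF.
  by rewrite E ler_pdivrMr ?powR_gt0 // [(eta * _)%R]mulrC -ler_pdivrMr.
(* The finite cover is padded with empty sets, which contribute 0. *)
pose V k := nth set0 [seq U L i | i <- enum (Q L)] k.
have Vsz k : (#|Q L| <= k)%N -> V k = set0.
  by move=> h; rewrite /V nth_default // size_map -cardE.
have Vd k : diameter (V k) <= (D / L%:R)%:E.
  have [kQ|kQ] := ltnP k #|Q L|; last first.
    by rewrite Vsz //; apply: ge_ereal_sup => z [x].
  rewrite /V (nth_map (enum_val (Ordinal kQ))) -?cardE //; apply: Ud => //.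
  by rewrite -mem_enum mem_nth // -cardE.
exists V; split.
- move=> x /(XU L L0) [i /= iQ Ux].
  have iQ' : (index i (enum (Q L)) < size (enum (Q L)))%N by rewrite index_mem
    mem_enum.
  exists (index i (enum (Q L))) => //.
  by rewrite /V (nth_map i) // nth_index // mem_enum.
- by move=> k; apply: le_trans (Vd k) _; rewrite lee_fin.
apply: nneseries_ub => [k|N]; first exact: diameter_pow_ge0.
apply: (@le_trans _ _ (#|Q L|%:R * (D / L%:R) `^ s)%:E); last first.
  rewrite lee_fin; apply: le_trans Leta; apply: ler_wpM2r (cardQ L L0).
  exact: powR_ge0.
apply: (@le_trans _ _ ((minn N #|Q L|)%:R * (D / L%:R) `^ s)%:E); last first.
  by rewrite lee_fin ler_wpM2r ?powR_ge0 // ler_nat geq_minr.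
elim: N => [|N IH]; first by rewrite big_geq // min0n mul0r.
rewrite big_nat_recr //=; have [NQ|NQ] := ltnP N #|Q L|.
  move: IH; rewrite (minn_idPl (ltnW NQ)) (minn_idPl NQ) -natr1 mulrDl mul1r
    EFinD => IH.
  by apply: leeD => //; apply: diameter_pow_le (Vd N); exact: ltW.
rewrite (minn_idPr _) ?(leq_trans NQ) // Vsz // /diameter_pow eqxx adde0.
by move: IH; rewrite (minn_idPr NQ).
Qed.

Lemma hausdorff_dim_le X (b : R) : (0 <= b)%R ->
  (forall s, (b < s)%R -> hausdorff_null s X) -> hausdorff_dim X <= b%:E.
Proof.
move=> b0 h; apply/lee_addgt0Pr => e e0.
apply: ereal_inf_lbound; exists (b + e)%R => //; split.
  by rewrite addr_ge0 // ltW.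
by apply: hausdorff_null_measure; apply: h; rewrite ltrDl.
Qed.

End hausdorff_null.

(** * Independent directions *)

Section directions.
Context {R : realType}.

Lemma euclidean_norm_le (n : nat) (x : 'rV[R]_n) (d : R) : 0 <= d ->
  (forall k, `|x 0 k| <= d) -> euclidean_norm x <= n%:R * d.
Proof.
move=> d0 xd; rewrite /euclidean_norm.
have nd0 : 0 <= n%:R * d by rewrite mulr_ge0.
rewrite -(ger0_norm nd0) -sqrtr_sqr ler_sqrt ?sqr_ge0 //.
apply: (@le_trans _ _ (\sum_(k < n) d ^+ 2)).
  apply: ler_sum => k _; rewrite -(real_normK (num_real (x 0 k))).
  by rewrite lerXn2r ?nnegrE.
rewrite sumr_const card_ord -[leLHS]mulr_natl exprMn; apply: ler_wpM2r;
  first exact: sqr_ge0.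
by rewrite -natrX ler_nat; case: n {x xd nd0} => // n;
  rewrite expnS leq_pmulr ?expn_gt0.
Qed.

Section hyperplane.
Variables (m : nat) (a : 'rV[R]_m.+2) (j : 'I_m.+2).
Hypothesis aj : a 0 j != 0.
Hypothesis a_max : forall k, `|a 0 k| <= `|a 0 j|.
Implicit Types x y : 'rV[R]_m.+2.

(** Solve the equation of the hyperplane for the coordinate whose coefficient is largest in absolute
    value. *)
Lemma hyperplane_coord x : \sum_k a 0 k * x 0 k = 0 ->
  `|x 0 j| <= \sum_k `|x 0 (lift j k)|.
Proof.
rewrite (bigD1_ord j) //= => /eqP; rewrite addr_eq0 => /eqP h.
have aj0 : 0 < `|a 0 j| by rewrite normr_gt0.
rewrite -(ler_pM2l aj0) -normrM h normrN mulr_sumr.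
apply: le_trans (ler_norm_sum _ _ _) _; apply: ler_sum => k _.
by rewrite normrM; apply: ler_wpM2r.
Qed.

(* A cell of the radial projection of the boundary of a cube to the sphere:
   [mu] is the sup norm of the coordinates other than [j], it is attained at
   [k0] with sign [b], and the remaining coordinates of [x / mu] lie in a cube
   of side [1 / L]. *)
Definition sphere_cell L (i : bool * 'I_m.+1 * {ffun 'I_m -> 'I_(2 * L).+1}) :
    set 'rV[R]_m.+2 :=
  [set x | [/\ unit_sphere x, \sum_k a 0 k * x 0 k = 0 & exists mu : R,
    [/\ 0 < mu, forall k, `|x 0 (lift j k)| <= mu,
      x 0 (lift j i.1.2) = (-1) ^+ i.1.1 * mu &
      forall l, (i.2 l)%:R <= L%:R * (x 0 (lift j (lift i.1.2 l)) / mu + 1)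
        < (i.2 l)%:R + 1]]].

Lemma sphere_cell_cover L : (0 < L)%N ->
  unit_sphere `&` [set x | \sum_k a 0 k * x 0 k = 0] `<=`
  \bigcup_i @sphere_cell L i.
Proof.
move=> L0 x [xS xa]; have L0' : 0 < L%:R :> R by rewrite ltr0n.
have [k0 _ k0max] := @arg_maxP _ R _ (ord0 : 'I_m.+1) xpredT (fun k =>
  `|x 0 (lift j k)|) isT.
pose mu := `|x 0 (lift j k0)|.
have xmu k : `|x 0 (lift j k)| <= mu by exact: k0max.
have mu0 : 0 < mu.
  rewrite lt_neqAle normr_ge0 andbT eq_sym; apply/negP => /eqP mu0.
  have x0 k : x 0 (lift j k) = 0.
    by apply/eqP; rewrite -normr_le0 -/mu (le_trans (xmu k)) // mu0.
  have xj0 : x 0 j = 0.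
    apply/eqP; rewrite -normr_le0; apply: le_trans (hyperplane_coord xa) _.
    by rewrite big1 // => k _; rewrite x0 normr0.
  move: xS; rewrite /unit_sphere /= /euclidean_norm big1 ?sqrtr0.
    by move=> /esym/eqP; rewrite oner_eq0.
  by move=> k _; case: (unliftP j k) => [k' ->|->]; rewrite ?x0 ?xj0 expr0n.
pose z l := L%:R * (x 0 (lift j (lift k0 l)) / mu + 1).
have z_bound l : 0 <= z l <= (2 * L)%:R.
  have := xmu (lift k0 l); rewrite ler_norml => /andP[h1 h2].
  have h3 : -1 <= x 0 (lift j (lift k0 l)) / mu by rewrite ler_pdivlMr //
    mulN1r.
  have h4 : x 0 (lift j (lift k0 l)) / mu <= 1 by rewrite ler_pdivrMr // mul1r.
  rewrite /z natrM mulr_ge0 ?(ltW L0') //=; last by move: (_ / _) h3 => t; lra.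
  by rewrite [2 * _]mulrC ler_pM2l //; move: (_ / _) h4 => t; lra.
have zL l : (Num.truncn (z l) < (2 * L).+1)%N.
  have /andP[h1 h2] := z_bound l; rewrite ltnS -(ler_nat R).
  by apply: le_trans h2; have /andP[] := truncn_itv h1.
exists (x 0 (lift j k0) < 0, k0, [ffun l => Ordinal (zL l)]) => //.
split => //; exists mu; split => //=.
  rewrite /mu; case: ltP => h; first by rewrite expr1 mulN1r ltr0_norm ?opprK.
  by rewrite expr0 mul1r ger0_norm.
by move=> l; rewrite ffunE /=; have /andP[h1 _] := z_bound l;
  have := truncn_itv h1; rewrite -natr1.
Qed.

(** The rescaled points [y = x / mu] and [y' = x' / mu'] are close in all coordinates but [j] by the
    choice of cell, and in [j] by the hyperplane equation. As [x] is a unit vector, [1 / mu] is the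
    norm of [y], so [mu] and [mu'] are close as well. *)
Lemma sphere_cell_diameter L i : (0 < L)%N ->
  (diameter (@sphere_cell L i) <=
    (m.+2%:R * (2 * m.+2%:R * m.+1%:R ^+ 3 + m.+1%:R) / L%:R)%:E)%E.
Proof.
move=> L0; have L0' : 0 < L%:R :> R by rewrite ltr0n.
apply: ge_ereal_sup => _ [x [xS xa [mu [mu0 xmu xk xl]]]
  [x' [xS' xa' [mu' [mu0' xmu' xk' xl']]]] <-].
rewrite lee_fin -mulrA.
set M : R := m.+1%:R; have M1 : 1 <= M by rewrite ler1n.
have M0 : 0 <= M by exact: le_trans M1.
pose y k := x 0 k / mu; pose y' k := x' 0 k / mu'.
have yx k : x 0 k = mu * y k by rewrite /y mulrCA mulfV ?mulr1 // gt_eqF.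
have yx' k : x' 0 k = mu' * y' k by rewrite /y' mulrCA mulfV ?mulr1 // gt_eqF.
have ya : \sum_k a 0 k * y k = 0.
  by under eq_bigr do rewrite /y mulrA; rewrite -mulr_suml xa mul0r.
have ya' : \sum_k a 0 k * y' k = 0.
  by under eq_bigr do rewrite /y' mulrA; rewrite -mulr_suml xa' mul0r.
have coord (u : 'I_m.+2 -> R) (d : R) : \sum_k a 0 k * u k = 0 ->
    (forall k, `|u (lift j k)| <= d) -> forall k, `|u k| <= M * d.
  move=> ua ud k; have d0 : 0 <= d by apply: le_trans (ud ord0).
  case: (unliftP j k) => [k' ->|->].
    by apply: le_trans (ud k') _; rewrite ler_peMl.
  have := @hyperplane_coord (\row_i u i).
  under eq_bigr do rewrite mxE; move=> /(_ ua); rewrite mxE => /le_trans; apply.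
  under eq_bigr do rewrite mxE.
  apply: le_trans (ler_sum _ (fun i _ => ud i)) _.
  by rewrite sumr_const card_ord /M mulr_natl.
have yM k : `|y k| <= M.
  rewrite -[M]mulr1; apply: coord => // {}k.
  by rewrite /y normrM normfV (gtr0_norm mu0) ler_pdivrMr // mul1r.
have yM' k : `|y' k| <= M.
  rewrite -[M]mulr1; apply: coord => // {}k.
  by rewrite /y' normrM normfV (gtr0_norm mu0') ler_pdivrMr // mul1r.
have dy k : `|y k - y' k| <= M / L%:R.
  apply: (coord (fun k => y k - y' k)).
    by under eq_bigr do rewrite mulrBr; rewrite sumrB ya ya' subr0.
  move=> {}k; case: (unliftP i.1.2 k) => [l ->|->].
    rewrite -[X in _ <= X]mul1r ler_pdivlMr // mulrC -{1}(gtr0_norm L0')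
      -normrM.
    have /andP[] := xl l; have /andP[] := xl' l; rewrite -/(y _) -/(y' _).
    move: (y _) (y' _) ((i.2 l)%:R : R) => p p' c h1 h2 h3 h4.
    rewrite ler_norml; nra.
  by rewrite /y /y' xk xk' !mulfK ?gt_eqF // subrr normr0 invr_ge0 ltW.
have nu_sqr (u : 'rV[R]_m.+2) (nu : R) : unit_sphere u -> 0 < nu ->
    \sum_k (u 0 k / nu) ^+ 2 = nu^-1 ^+ 2.
  move=> uS nu0; under eq_bigr do rewrite exprMn; rewrite -mulr_suml.
  rewrite -[X in X * _](sqr_sqrtr (sumr_ge0 _ (fun k _ => sqr_ge0 (u 0 k)))).
  by rewrite -/(euclidean_norm u) (_ : euclidean_norm u = 1) // expr1n mul1r.
have nu_ge1 (u : 'rV[R]_m.+2) (nu : R) : unit_sphere u -> 0 < nu ->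
    u 0 (lift j i.1.2) = (-1) ^+ i.1.1 * nu -> 1 <= nu^-1.
  move=> uS nu0 uk; rewrite -(ler_pXn2r (ltn0Sn 1)) ?nnegrE ?invr_ge0 ?(ltW
    nu0) //.
  rewrite -(nu_sqr u) // (bigD1 (lift j i.1.2)) //= uk mulfK ?gt_eqF //.
  by rewrite expr1n sqrr_sign lerDl sumr_ge0 // => k _; exact: sqr_ge0.
have nu1 := nu_ge1 x mu xS mu0 xk; have nu1' := nu_ge1 x' mu' xS' mu0' xk'.
have dnu : `|mu^-1 ^+ 2 - mu'^-1 ^+ 2| <= m.+2%:R * (M / L%:R * (2 * M)).
  rewrite -(nu_sqr x) // -(nu_sqr x') // -sumrB.
  apply: le_trans (ler_norm_sum _ _ _) _.
  apply: (@le_trans _ _ (\sum_(k < m.+2) (M / L%:R * (2 * M)))); last first.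
    by rewrite sumr_const card_ord -[leLHS]mulr_natl.
  apply: ler_sum => k _; rewrite -/(y k) -/(y' k) subr_sqr normrM.
  apply: ler_pM => //; apply: le_trans (ler_normD _ _) _.
  by have := yM k; have := yM' k; lra.
(* Both inverses are at least 1, so passing from [mu] to [1 / mu] and then to its square does not
   decrease the difference. *)
have dmu : `|mu - mu'| <= m.+2%:R * (M / L%:R * (2 * M)).
  apply: le_trans dnu; set p := mu^-1 in nu1 *; set r := mu'^-1 in nu1' *.
  have -> : mu - mu' = (r - p) / (p * r).
    by rewrite /p /r; field; rewrite !gt_eqF.
  rewrite subr_sqr [leLHS]normrM [leRHS]normrM (distrC r p);
    apply: ler_wpM2l => //.
  have pr1 : 1 <= p * r by rewrite -[1]mulr1; apply: ler_pM.
  have pr0 : 0 <= (p * r)^-1 by rewrite invr_ge0; lra.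
  have ps0 : 0 <= p + r by lra.
  rewrite (ger0_norm pr0) (ger0_norm ps0); apply: (@le_trans _ _ 1);
    last by lra.
  by rewrite invf_le1 //; lra.
apply: euclidean_norm_le;
  first by rewrite divr_ge0 // addr_ge0 // !mulr_ge0 // exprn_ge0.
move=> k; rewrite !mxE yx yx'.
have -> : mu * y k - mu' * y' k = mu * (y k - y' k) + (mu - mu') * y' k by ring.
apply: le_trans (ler_normD _ _) _; rewrite (normrM mu) (normrM (mu - mu')).
have mu1 : `|mu| <= 1 by rewrite gtr0_norm // -invf_ge1.
have -> : (2 * m.+2%:R * M ^+ 3 + M) / L%:R =
    1 * (M / L%:R) + m.+2%:R * (M / L%:R * (2 * M)) * M.
  by field; rewrite gt_eqF.
apply: lerD; first by apply: ler_pM => //; exact: dy.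
by apply: ler_pM => //; exact: yM'.
Qed.

(** The number of cells grows like [L^m] and their diameter like [1 / L], which is negligible in
    dimension [m.+1]. *)
Lemma sphere_hyperplane_null :
  hausdorff_null m.+1%:R
    (unit_sphere `&` [set x | \sum_k a 0 k * x 0 k = 0]).
Proof.
have c0 : 0 < m.+2%:R * (2 * m.+2%:R * m.+1%:R ^+ 3 + m.+1%:R) :> R.
  by rewrite mulr_gt0 // addr_gt0 // !mulr_gt0 // exprn_gt0.
apply: (@hausdorff_null_finite_covers R _ _ _
  (fun L => (bool * 'I_m.+1 * {ffun 'I_m -> 'I_(2 * L).+1})%type)
  (fun L => finset.setT) (fun L => @sphere_cell L) (2 * m.+1 * 3 ^ m)%:R
  (m.+2%:R * (2 * m.+2%:R * m.+1%:R ^+ 3 + m.+1%:R)) m) => //.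
- by rewrite ltr_nat.
- move=> L L0 x /(sphere_cell_cover L0) [i _ xi]; exists i => //=.
  by rewrite inE.
- by move=> L L0 i _; exact: sphere_cell_diameter.
move=> L L0; rewrite -natrM ler_nat cardsT !card_prod card_bool card_ffun
  !card_ord.
(* This is [2 L + 1 <= 3 L], valid because [L > 0]. *)
rewrite -[leqRHS]mulnA -expnMn leq_mul2l; apply/orP; right.
by case: m => // k; rewrite leq_exp2r //; lia.
Qed.

End hyperplane.

Lemma sphere_hyperplane_measure0 n (a : 'rV[R]_n.+1) (D : set 'rV[R]_n.+1) :
  a != 0 -> D `<=` unit_sphere -> (forall x, D x -> \sum_k a 0 k * x 0 k = 0) ->
  hausdorff_measure n%:R D = 0%E.
Proof.
move=> a0 DS Da; apply: hausdorff_null_measure.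
have [j _ jmax] := @arg_maxP _ R _ (ord0 : 'I_n.+1) xpredT (fun k =>
  `|a 0 k|) isT.
have aj : a 0 j != 0.
  apply: contra a0 => /eqP aj; apply/eqP/rowP => k; rewrite mxE.
  by apply/eqP; rewrite -normr_le0; have := jmax k isT; rewrite aj normr0.
case: n => [|m] in a D a0 DS Da j aj jmax *; last first.
  apply: hausdorff_null_subset (sphere_hyperplane_null aj (fun k =>
    jmax k isT)).
  by move=> x Dx; split; [exact: DS|exact: Da].
(* In dimension one the hyperplane is the origin, which is not on the sphere; [D] is empty. *)
have D0 x : ~ D x.
  move=> Dx; have := Da x Dx; rewrite big_ord1 => /eqP; rewrite mulf_eq0.
  rewrite (ord1 j) in aj; rewrite (negbTE aj) /= => /eqP x0.
  have := DS x Dx; rewrite /unit_sphere /= /euclidean_norm big_ord1 x0 expr0n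
    sqrtr0.
  by move=> /esym/eqP; rewrite oner_eq0.
move=> eta d eta0 d0; exists (fun=> set0); split => [x /D0//|k|].
  by apply: ge_ereal_sup => z [x].
apply: nneseries_ub => [k|N]; first exact: diameter_pow_ge0.
by rewrite big1 ?lee_fin ?ltW // => k _; rewrite /diameter_pow eqxx.
Qed.

(** Take a maximal independent family in [D]. If it did not span, [D] would lie in its row space,
    hence in the hyperplane given by a non-zero column of the cokernel, and would have measure
    zero. *)
Lemma independent_directions n (D : set 'rV[R]_n.+1) :
  positive_surface_measure D ->
  exists2 T : 'M[R]_n.+1, T \in unitmx & forall i, D (row i T).
Proof.
move=> [DS _ Dpos].
pose P k := `[< exists2 T :
  'M[R]_(k, n.+1), row_free T & forall i, D (row i T) >].
have P0 : P 0%N by apply/asboolP; exists 0 => [|[]//];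
  rewrite /row_free -leqn0 rank_leq_row.
have Pn k : P k -> (k <= n.+1)%N.
  by move=> /asboolP [T /eqP rT _]; rewrite -rT rank_leq_col.
have [k /asboolP [T Tfree TD] kmax] := ex_maxnP (ex_intro _ 0%N P0) Pn.
have [kn|kn] := eqVneq k n.+1.
  by subst k; exists T; rewrite // -row_free_unit.
have {}kn : (k < n.+1)%N by rewrite ltn_neqAle kn Pn //; apply/asboolP;
  exists T.
have DT x : D x -> (x <= T)%MS.
  move=> Dx; apply/negPn/negP => nxT.
  have : P (1 + k)%N.
    apply/asboolP; exists (col_mx x T).
      rewrite /row_free eqn_leq rank_leq_row /= -addsmxE.
      have : (\rank T < \rank (x + T)%MS)%N.
        by apply: rank_ltmx; rewrite ltmxE addsmxSr addsmx_sub submx_refl andbT.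
      by move: Tfree; rewrite /row_free => /eqP ->.
    move=> i; case: (split_ordP i) => i' ->; first by rewrite rowKu row_id.
    by rewrite rowKd.
  by move=> /kmax; rewrite add1n ltnn.
have ck : cokermx T != 0.
  by rewrite -mxrank_eq0 mxrank_coker (eqP Tfree) -lt0n subn_gt0.
have [j cj] : exists j, col j (cokermx T) != 0.
  apply/existsP; apply: contraNT ck; rewrite negb_exists => /forallP h.
  apply/eqP/matrixP => r j; have := h j; rewrite negbK => /eqP/colP/(_ r).
  by rewrite !mxE.
suff Dnull : hausdorff_measure n%:R D = 0%E by move: Dpos;
  rewrite /= Dnull ltxx.
apply: (@sphere_hyperplane_measure0 n (col j (cokermx T))^T) => //.
  by rewrite trmx_eq0.
move=> x /DT; rewrite submxE => /eqP/matrixP/(_ 0 j); rewrite !mxE => h.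
by rewrite -[RHS]h; apply: eq_bigr => k' _; rewrite !mxE mulrC.
Qed.
End directions.

(** * The exceptional set *)

Section assembly.
Context {R : realType} {H : hilbertType R} {n : nat}.
Local Open Scope complex_scope.
Local Notation RR := (measurableTypeR R).

(* With the sum of all rows as first vector, the first form dominates the
   others. *)
Definition cone_basis (T : 'M[R]_n.+1) (j : 'I_n.+1) : 'rV[R]_n.+1 :=
  if j == ord0 then \sum_i row i T else row j T.

(** If [c] are the coordinates in the rows of [T], then [t] is [c_0] times the sum of all rows plus
    [(c_j - c_0)] times row [j] for [j > 0]. *)
Definition cone_coord (T : 'M[R]_n.+1) (t : 'rV[R]_n.+1) : 'rV[R]_n.+1 :=
  let c := t *m invmx T in \row_j (if j == ord0 then c 0 ord0 else c 0 j - c 0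
    ord0).

Lemma cone_coordB T t t' :
  cone_coord T (t - t') = cone_coord T t - cone_coord T t'.
Proof.
by apply/rowP => j; rewrite /cone_coord mulmxBl !mxE; case: ifP => // _; ring.
Qed.

Lemma cone_coordE T t : T \in unitmx ->
  t = \sum_j cone_coord T t 0 j *: cone_basis T j.
Proof.
move=> uT; set c := t *m invmx T.
have tc : t = \sum_j c 0 j *: row j T by rewrite -mulmx_sum_row /c mulmxKV.
have q0 : cone_coord T t 0 ord0 = c 0 ord0 by rewrite /cone_coord mxE.
have qS j : cone_coord T t 0 (lift ord0 j) = c 0 (lift ord0 j) - c 0 ord0.
  by rewrite /cone_coord mxE.
rewrite [RHS]big_ord_recl q0 /cone_basis eqxx [LHS]tc !big_ord_recl scalerDr
  -addrA.
congr (_ + _); rewrite scaler_sumr -big_split /=; apply: eq_bigr => j _.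
by rewrite qS -scalerDl addrC subrK.
Qed.

Lemma cone_coord_diff T t t' : T \in unitmx ->
  t - t' = \sum_j (cone_coord T t - cone_coord T t') 0 j *: cone_basis T j.
Proof. by move=> uT; rewrite {1}(cone_coordE (t - t') uT) cone_coordB. Qed.

Lemma in_cell_exists (L M : nat) (q : 'rV[R]_n.+1) : (0 < L)%N ->
  (forall j, `|q 0 j| < M%:R) ->
  exists i : {ffun 'I_n.+1 -> 'I_(2 * M * L)}, in_cell L M q i.
Proof.
move=> L0 qM; have L0' : 0 < L%:R :> R by rewrite ltr0n.
pose z j := L%:R * (q 0 j + M%:R).
have zb j : 0 <= z j < (2 * M * L)%:R.
  have := qM j; rewrite ltr_norml => /andP[h1 h2]; apply/andP; split.
    by rewrite /z mulr_ge0 ?(ltW L0') //; lra.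
  by rewrite /z mulrC natrM ltr_pM2r // natrM; lra.
have zL j : (Num.truncn (z j) < 2 * M * L)%N.
  have /andP[h1 h2] := zb j; rewrite -(ltr_nat R).
  by apply: le_lt_trans h2; have /andP[] := truncn_itv h1.
exists [ffun j => Ordinal (zL j)] => j; rewrite ffunE /=.
by have /andP[h1 _] := zb j; have := truncn_itv h1; rewrite -natr1.
Qed.

Lemma cell_diameter (L M J : nat) (T : 'M[R]_n.+1) (i : {ffun 'I_n.+1 ->
  'I_J}) :
  (0 < L)%N -> T \in unitmx ->
  (diameter [set t | in_cell L M (cone_coord T t) i] <=
    (n.+1%:R * (1 + \sum_j \sum_k `|cone_basis T j 0 k|) / L%:R)%:E)%E.
Proof.
move=> L0 uT; have L0' : 0 < L%:R :> R by rewrite ltr0n.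
apply: ge_ereal_sup => _ [t /= ti [t' /= ti' <-]].
have S0 : 0 <= \sum_j \sum_k `|cone_basis T j 0 k|.
  by apply: sumr_ge0 => j _; apply: sumr_ge0.
rewrite lee_fin -mulrA; apply: euclidean_norm_le.
  by rewrite divr_ge0 // addr_ge0.
move=> k; rewrite (cone_coord_diff t t' uT) summxE.
apply: le_trans (ler_norm_sum _ _ _) _.
apply: (@le_trans _ _ (\sum_j `|cone_basis T j 0 k| / L%:R)).
  apply: ler_sum => j _; rewrite mxE normrM mulrC; apply: ler_wpM2l => //.
  rewrite -[X in _ <= X]mul1r ler_pdivlMr // mulrC -{1}(gtr0_norm L0') -normrM
    !mxE.
  have /andP[] := ti j; have /andP[] := ti' j; rewrite !mxE.
  move: (if _ then _ else _) (if _ then _ else _) ((i j)%:R : R) =>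
    p p' c h1 h2 h3 h4.
  rewrite ler_norml; nra.
rewrite -mulr_suml ler_pM2r ?invr_gt0 //.
apply: (@le_trans _ _ (\sum_j \sum_k `|cone_basis T j 0 k|));
  last by rewrite lerDr.
by apply: ler_sum => j _; rewrite (bigD1 k) //= lerDl sumr_ge0.
Qed.

Variable K : 'I_n.+1 -> {linear H -> H}.

Lemma combination_trace_bound (t : 'rV[R]_n.+1) :
  (forall k, trace_class (K k)) ->
  exists2 C : R, 0 < C & forall (I : finType) (e : I -> H),
    (forall i j, i != j -> rip (e i) (e j) = 0) ->
    (forall i, rip (e i) (e i) <= 1) ->
    \sum_i rip (combination K t (e i)) (e i) <= C.
Proof.
move=> Ktr; have /choice [C hC] : forall k, exists C : R, forall (I :
  finType) (e : I -> H),
    (forall i j, i != j -> rip (e i) (e j) = 0) ->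
    (forall i, rip (e i) (e i) <= 1) -> \sum_i `|rip (K k (e i)) (e i)| <= C.
  by move=> k; exact: trace_class_bound.
exists (1 + \sum_k `|t 0 k| * `|C k|).
  by rewrite ltr_pwDl // sumr_ge0 // => k _; rewrite mulr_ge0.
move=> I e e0 e1.
have -> : \sum_i rip (combination K t (e i)) (e i) =
    \sum_k \sum_i t 0 k * rip (K k (e i)) (e i).
  rewrite exchange_big; apply: eq_bigr => i _; rewrite /combination rip_suml.
  by apply: eq_bigr => k _; rewrite ripZl.
apply: (@le_trans _ _ (\sum_k `|t 0 k| * `|C k|)); last by rewrite lerDr.
apply: ler_sum => k _; rewrite -mulr_sumr.
apply: le_trans (ler_norm _) _; rewrite normrM; apply: ler_wpM2l => //.
apply: le_trans (ler_norm_sum _ _ _) _; apply: le_trans (hC k I e e0 e1) _.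
exact: ler_norm.
Qed.

Variable T : 'M[R]_n.+1.
Hypothesis T_ge0 : forall i, nonneg_op (combination K (row i T)).

Lemma cone_basis_ge0 j : nonneg_op (combination K (cone_basis T j)).
Proof.
rewrite /cone_basis; case: eqP => // _ x.
by rewrite combination_suml linear_sumlz /=; apply: sumr_ge0 => i _;
  exact: T_ge0.
Qed.

Lemma cone_basis_le j x :
  rip (combination K (cone_basis T j) x) x <=
  rip (combination K (cone_basis T ord0) x) x.
Proof.
rewrite /cone_basis eqxx; case: eqP => // _.
rewrite combination_suml rip_suml (bigD1 j) //= lerDl sumr_ge0 // => i _.
by have := T_ge0 i x; rewrite lecE => /andP[].
Qed.

End assembly.

Theorem theorem1p6 (R : realType) (H : hilbertType R)
    (H_separable : exists2 S : set H, countable S & dense S)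
    (n : nat) (n_gt0 : (0 < n)%N)
    (A : {linear H -> H}) (K : 'I_n -> {linear H -> H})
    (A_bounded : bounded_op A) (A_sa : self_adjoint A)
    (K_bounded : forall k, bounded_op (K k))
    (K_sa : forall k, self_adjoint (K k))
    (K_trace : forall k, trace_class (K k))
    (D : set 'rV[R]_n) (D_pos : positive_surface_measure D)
    (D_nonneg : forall tau, D tau -> nonneg_op (combination K tau))
    (D_cyclic : forall tau, D tau ->
       cyclic_set A (range (combination K tau)))
    (sigma : {measure set (measurableTypeR R) -> \bar R})
    (sigma_radon : radon_measure sigma)
    (sigma_singular : mutually_singular sigma (@lebesgue_measure R)) :
  exists2 E : set 'rV[R]_n, (hausdorff_dim E <= (n.-1%:R)%:E)%E &
    forall t : 'rV[R]_n, ~ E t ->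
      forall P : projection_measure H,
        is_spectral_measure_of (perturbation A K t) P ->
        forall x : H, maximal_spectral_type P x ->
          mutually_singular (scalar_measure P x) sigma.
Proof.
case: n n_gt0 K K_bounded K_sa K_trace D D_pos D_nonneg D_cyclic => // n _.
move=> K K_bounded K_sa K_trace D D_pos D_nonneg D_cyclic.
have [T uT TD] := independent_directions D_pos.
have [S cS dS] := H_separable.
have T_ge0 i : nonneg_op (combination K (row i T)) by exact: D_nonneg.
have [C C0 trC] := combination_trace_bound (cone_basis T ord0) K_trace.
have [code code_inj] : exists f : H -> nat, {in S &, injective f}.
  exact/countable_injP.
(* An enumeration of the dense set by codes; numbers that are not codes get the vector 0. *)
have /choice [w hw] : forall k, exists w, forall y, S y -> code y = k -> w = y.
  move=> k; have [[y [Sy yk]]|no] := pselect (exists y, S y /\ code y = k).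
    by exists y => z Sz zk; apply: code_inj; rewrite ?inE // yk zk.
  by exists 0 => y Sy yk; exfalso; apply: no; exists y.
(* The indices are the direction, the code of the vector, the integer of [dominated_at] and a bound
   on the coordinates, which keeps the number of cells finite. *)
pose X (i : 'I_n.+1 * nat * nat * nat) : set 'rV[R]_n.+1 :=
  [set t | dominated_at A K sigma
     (combination K (cone_basis T i.1.1.1) (w i.1.1.2)) i.1.2 t /\
   forall j, `|cone_coord T t 0 j| < i.2%:R].
have sigma_fin := sigma_radon.1.
have Xnull s i : n%:R < s -> hausdorff_null s (X i).
  move=> ns; case: i => [[[j k] a] M].
  have [Y Y0 hY] := exceptional_cells K_sa A_sa sigma_fin
    (fun t t' => cone_coord_diff t t' uT) (cone_basis_ge0 T_ge0)
    (cone_basis_le T_ge0) C0 trC j (w k) a M.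
  apply: (@hausdorff_null_finite_covers R _ _ _
    (fun L => {ffun 'I_n.+1 -> 'I_(2 * M * L)})
    (fun L => [set i | `[< exists2 t,
      dominated_at A K sigma (combination K (cone_basis T j) (w k)) a t &
      in_cell L M (cone_coord T t) i >] ]%SET)
    (fun L i => [set t | in_cell L M (cone_coord T t) i]) Y
    (n.+1%:R * (1 + \sum_j \sum_k `|cone_basis T j 0 k|)) n) => //.
  - rewrite mulr_gt0 // ltr_pwDl //.
    by apply: sumr_ge0 => ? _; apply: sumr_ge0.
  - move=> L L0 t [dom tM]; have [i ti] := in_cell_exists L0 tM.
    by exists i => //=; rewrite inE; apply/asboolP; exists t.
  - by move=> L L0 i _; exact: cell_diameter.
pose F m := if unpickle m is Some i then X i else set0.
exists (\bigcup_m F m).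
  apply: hausdorff_dim_le => // s ns; apply: hausdorff_null_bigcup => m.
  rewrite /F; case: unpickle => [i|]; first exact: Xnull.
  exact: (hausdorff_null_subset _ (Xnull s (ord0, 0%N, 0%N, 0%N) ns)).
(* It suffices to treat the vectors [K_(tau_j) y] with [y] in the dense set; a non-singular one
   would put [t] in some [X i]. *)
move=> t nt P TP x _; apply: (singular_everywhere K_sa A_sa K_bounded dS _
  (D_cyclic _ (TD ord0)) TP (tau := cone_basis T)).
  by move=> t'; exists (fun j => cone_coord T t' 0 j); exact: cone_coordE.
move=> j y Sy; apply: contrapT => nsing; apply: nt.
have [|a [G [cG GA G0 sG Gdom]]] :=
  not_singular_comparison _ sigma_radon sigma_singular nsing.
  apply: le_lt_trans (ltry (rip (combination K (cone_basis T j) y) _)).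
  exact: scalar_measure_le.
(* The sum of the integer parts, plus one, strictly exceeds every coordinate in absolute value. *)
pose M := (\sum_j Num.truncn `|(cone_coord T t 0 j)%R|).+1.
exists (pickle (j, code y, a, M)) => //; rewrite /F pickleK; split => /=.
  rewrite (hw _ y Sy erefl); exists P; split => //.
  by exists G.
move=> k; apply: lt_le_trans (truncnS_gt _) _; rewrite ler_nat ltnS.
by rewrite (bigD1 k) //= leq_addr.
Qed.
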